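(* Let $X$ be a non-trivial conjugacy class of $G=\mathrm{PSL}(2,9)\cong\mathbb{A}_6$ (identified with $\mathbb{A}_6$). (1) The Schur multiplier of $G$ relative to $X$ is (a) the cyclic group of order two if $X=(1\,2\,3)^{\mathbb{A}_6}$ or $X=(1\,2\,3)(4\,5\,6)^{\mathbb{A}_6}$, (b) the cyclic group of order three if $X=(1\,2)(3\,4)^{\mathbb{A}_6}$, (c) the cyclic group of order six if $X$ is one of the classes $(1\,2\,3\,4)(5\,6)^{\mathbb{A}_6}$, $(1\,2\,3\,4\,5)^{\mathbb{A}_6}$ and $(1\,2\,3\,4\,6)^{\mathbb{A}_6}$. (2) The associated group $\mathrm{As}(X)$ of $X$ is isomorphic to the quotient of $\mathbb{A}_6^*\times\mathbb{Z}$ by the unique central subgroup of $\mathbb{A}_6^*$ of order $n(X)$, where $n((1\,2\,3)^{\mathbb{A}_6})=n((1\,2\,3)(4\,5\,6)^{\mathbb{A}_6})=3$, $n((1\,2)(3\,4)^{\mathbb{A}_6})=2$, $n((1\,2\,3\,4)(5\,6)^{\mathbb{A}_6})=n((1\,2\,3\,4\,5)^{\mathbb{A}_6})=n((1\,2\,3\,4\,6)^{\mathbb{A}_6})=1$.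
   Context: $\mathbb{A}_6$ is the alternating group of degree six and $g^{\mathbb{A}_6}$ is the conjugacy class of $g$; the classes listed are all the non-trivial conjugacy classes of $\mathbb{A}_6$. $\mathbb{A}_6^*$ denotes the Schur covering group of $\mathbb{A}_6$ (the universal central extension of the perfect group $\mathbb{A}_6$, unique up to isomorphism); its center is cyclic of order $6$. $X$ is a rack via $x\triangleright y=xyx^{-1}$. Let $F_X$ be the free group on symbols $g_x$, $x\in X$. The associated group is $\mathrm{As}(X)=F_X/R_0$, where $R_0$ is the normal closure of all $g_xg_yg_x^{-1}g_{x\triangleright y}^{-1}$, $x,y\in X$. Relative Schur multiplier of a perfect group $G$ generated by a conjugacy class $X$: let $\pi:F_X\to G$, $g_x\mapsto x$, and $R_X=\ker\pi$. The Schur multiplier is $M(G)=(R_X\cap[F_X,F_X])/[F_X,R_X]$. For $x\in X$ let $\mu_x:C_G(x)\to M(G)$ be the group homomorphism with $\mu_x(g)=hyh^{-1}y^{-1}$ for any preimages $h$ of $g$ and $y$ of $x$ under the map $F_X/[F_X,R_X]\to G$ induced by $\pi$. The subgroup $\mu_x(C_G(x))$ does not depend on $x\in X$, and the Schur multiplier of $G$ relative to $X$ is $M(G)/\mu_x(C_G(x))$. *)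

(* Defs.v *)
From HB Require Import structures.
From mathcomp Require Import all_boot all_order all_algebra.
From mathcomp Require Import fingroup perm alt.
From mathcomp Require Import boolp classical_sets functions cardinality.

Set Implicit Arguments.
Unset Strict Implicit.
Unset Printing Implicit Defensive.

Import GroupScope.
(* [fingroup] also exports a [repr], for cosets. *)
Local Notation repr := generic_quotient.repr.
Local Open Scope quotient_scope.
Local Open Scope classical_set_scope.

(* Groups are [groupType]s (possibly infinite), subgroups are classical sets. *)

Definition group_iso (G H : groupType) : Prop :=
  exists f : G -> H, bijective f /\ {morph f : x y / x * y}.

Section Subgroups.
Variable G : groupType.
Implicit Types A B H : set G.

Definition is_subgroup H : Prop :=
  [/\ H 1, (forall x y, H x -> H y -> H (x * y)) & (forall x, H x -> H x^-1)].

Definition is_normal H : Prop :=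
  is_subgroup H /\ (forall g x, H x -> H (g * x * g^-1)).

Definition normal_closure A : set G := smallest is_normal A.

Definition commutator_subgroup A B : set G :=
  smallest is_subgroup [set [~ a, b] | a in A & b in B].

Definition center : set G := [set z | forall g, z * g = g * z].

Definition conj_class (g : G) : set G := [set h * g * h^-1 | h in setT].

Definition is_nontrivial_class (X : set G) : Prop :=
  exists2 g : G, g != 1 & X = conj_class g.

Lemma smallest_is_subgroup A : is_subgroup (smallest is_subgroup A).
Proof.
split=> [H [[H1 _ _] _]|x y Hx Hy H|x Hx H] //.
- by move=> HA; case: (HA) => -[_ HM _] _; apply: HM; [exact: Hx|exact: Hy].
- by move=> HA; case: (HA) => -[_ _ HV] _; apply: HV; exact: Hx.
Qed.

Lemma normal_closure_normal A : is_normal (normal_closure A).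
Proof.
split; first split=> [H [[[H1 _ _] _] _]|x y Hx Hy H|x Hx H] //.
- move=> HA; case: (HA) => -[[_ HM _] _] _.
  by apply: HM; [exact: Hx|exact: Hy].
- by move=> HA; case: (HA) => -[[_ _ HV] _] _; apply: HV; exact: Hx.
- by move=> g x Hx H HA; case: (HA) => -[_ HJ] _; apply: HJ; exact: Hx.
Qed.

Lemma sub_normal_closure A : A `<=` normal_closure A.
Proof. by move=> x Ax H [_]; apply. Qed.

Lemma normal_closure_id H : is_normal H -> normal_closure H = H.
Proof.
move=> nH; apply/seteqP; split; last exact: sub_normal_closure.
by move=> x Hx; apply: Hx; split.
Qed.

End Subgroups.

(* The group structure of a subset [H] which is a subgroup. *)
Section SubgroupType.
Variables (G : groupType) (H : set G) (sgH : is_subgroup H).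

Definition subgroup_type of is_subgroup H : Type := {x : G | x \in H}.
Local Notation S := (subgroup_type sgH).

HB.instance Definition _ := SubChoice.on S.

Lemma subgroup_closed : group_closed (fun x : G => x \in H).
Proof.
case: sgH => H1 HM HV; split=> [|x y]; rewrite !inE; first exact: H1.
by move=> Hx Hy; apply: HM => //; apply: HV.
Qed.

HB.instance Definition _ := SubChoice_isSubGroup.Build G _ S subgroup_closed.

End SubgroupType.

(* [quot_group A] is the quotient of [G] by the normal closure of [A]; this is
   the usual quotient [G / A] if [A] is a normal subgroup, by
   [normal_closure_id]. *)
Section Quotient.
Variables (G : groupType) (A : set G).
Local Notation N := (normal_closure A).

Definition coset_rel (x y : G) : bool := `[< N (x^-1 * y) >].

Lemma coset_rel_equiv : equiv_class_of coset_rel.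
Proof.
have [[N1 NM NV] _] := normal_closure_normal A.
split=> [x|x y|y x z]; first by apply/asboolP; rewrite mulVg.
  by apply/asboolP/asboolP => /NV; rewrite invgM invgK.
move=> /asboolP xy /asboolP yz; apply/asboolP.
by have := NM _ _ xy yz; rewrite mulgA mulgK.
Qed.

Canonical coset_equiv := EquivRelPack coset_rel_equiv.

Definition quot_group : Type := {eq_quot coset_equiv}.
HB.instance Definition _ := Choice.on quot_group.
HB.instance Definition _ := EqQuotient.on quot_group.

Definition quot_pi (x : G) : quot_group := \pi x.

Lemma quot_piP x y : quot_pi x = quot_pi y <-> N (x^-1 * y).
Proof. by split=> [/eqmodP/asboolP|/asboolP h]//; apply/eqmodP. Qed.

Definition quot_mul (a b : quot_group) := quot_pi (repr a * repr b).
Definition quot_inv (a : quot_group) := quot_pi (repr a)^-1.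

Lemma quot_reprK a : quot_pi (repr a) = a. Proof. exact: reprK. Qed.

Lemma quot_mulE x y : quot_mul (quot_pi x) (quot_pi y) = quot_pi (x * y).
Proof.
have [[N1 NM NV] NJ] := normal_closure_normal A.
have /quot_piP hx := quot_reprK (quot_pi x).
have /quot_piP hy := quot_reprK (quot_pi y).
rewrite /quot_mul; move: (repr _) hx (repr _) hy => a hx b hy; apply/quot_piP.
by have := NM _ _ (NJ b^-1 _ hx) hy; rewrite invgM invgK !mulgA mulgK.
Qed.

Lemma quot_invE x : quot_inv (quot_pi x) = quot_pi x^-1.
Proof.
have [[N1 NM NV] NJ] := normal_closure_normal A.
have /quot_piP hx := quot_reprK (quot_pi x).
apply/quot_piP; rewrite invgK; have := NJ x _ (NV _ hx).
by rewrite invgM invgK !mulgA mulgV mul1g.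
Qed.

Lemma quot_mulA : associative quot_mul.
Proof.
move=> a b c; rewrite -(quot_reprK a) -(quot_reprK b) -(quot_reprK c).
by rewrite !quot_mulE mulgA.
Qed.

Lemma quot_mul1g : left_id (quot_pi 1) quot_mul.
Proof. by move=> a; rewrite -(quot_reprK a) quot_mulE mul1g. Qed.

Lemma quot_mulg1 : right_id (quot_pi 1) quot_mul.
Proof. by move=> a; rewrite -(quot_reprK a) quot_mulE mulg1. Qed.

Lemma quot_mulVg : left_inverse (quot_pi 1) quot_inv quot_mul.
Proof. by move=> a; rewrite -(quot_reprK a) quot_invE quot_mulE mulVg. Qed.

Lemma quot_mulgV : right_inverse (quot_pi 1) quot_inv quot_mul.
Proof. by move=> a; rewrite -(quot_reprK a) quot_invE quot_mulE mulgV. Qed.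

HB.instance Definition _ := isGroup.Build quot_group
  quot_mulA quot_mul1g quot_mulg1 quot_mulVg quot_mulgV.

Lemma quot_pi_morphism : monoid_morphism quot_pi.
Proof. by split=> // x y; rewrite -quot_mulE. Qed.

HB.instance Definition _ :=
  isUMagmaMorphism.Build G quot_group quot_pi quot_pi_morphism.

Lemma quot_piM : {morph quot_pi : x y / x * y}. Proof. exact: gmulfM. Qed.
Lemma quot_piV : {morph quot_pi : x / x^-1}. Proof. exact: gmulfV. Qed.

End Quotient.

(* The free group on [T]: reduced words in the letters [(x, false)], for the
   generator [x], and [(x, true)], for its inverse. *)
Section FreeGroup.
Variable T : choiceType.
Implicit Types (a b : T * bool) (u v w : seq (T * bool)).

Definition letter_inv a := (a.1, ~~ a.2).

Definition reduced w := sorted (fun a b => b != letter_inv a) w.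

Definition push a w :=
  if w is b :: w' then if b == letter_inv a then w' else a :: w else [:: a].

Definition word_mul u v := foldr push v u.
Definition word_inv u := rev (map letter_inv u).

Record free_group := FreeGroup { word :> seq (T * bool); _ : reduced word }.

HB.instance Definition _ := [isSub for word].
HB.instance Definition _ := [Choice of free_group by <:].

Lemma letter_invK : involutive letter_inv.
Proof. by case=> x b; rewrite /letter_inv /= negbK. Qed.

Lemma reduced_push a w : reduced w -> reduced (push a w).
Proof.
case: w => //= b w; case: ifP => /= [_|/negbT->//].
by rewrite /reduced; case: w => //= c w /andP[].
Qed.

Lemma pushK a w : reduced w -> push a (push (letter_inv a) w) = w.
Proof.
case: w => [|b w] /=; first by rewrite eqxx.
rewrite letter_invK; case: eqP => [->|] /=; last by rewrite eqxx.
by rewrite /reduced; case: w => //= c w /andP[/negPf->].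
Qed.

Lemma reduced_mul u v : reduced v -> reduced (word_mul u v).
Proof. by move=> rv; elim: u => //= a u; apply: reduced_push. Qed.

Lemma reduced_inv u : reduced u -> reduced (word_inv u).
Proof.
rewrite /reduced /word_inv rev_sorted sorted_map; apply: sub_sorted => a b /=.
by rewrite letter_invK eq_sym.
Qed.

Lemma reduced_behead a w : reduced (a :: w) -> reduced w.
Proof. exact: path_sorted. Qed.

Lemma word_mul_push a u v :
  reduced v -> word_mul (push a u) v = push a (word_mul u v).
Proof.
move=> rv; case: u => //= b u; case: eqP => //= ->.
by rewrite pushK //; apply: reduced_mul.
Qed.

Lemma word_mulA u v w :
  reduced w -> word_mul u (word_mul v w) = word_mul (word_mul u v) w.
Proof. by move=> rw; elim: u => //= a u ->; rewrite word_mul_push. Qed.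

Lemma word_mulg1 u : reduced u -> word_mul u [::] = u.
Proof.
elim: u => //= a u IHu rau; rewrite IHu; last exact: reduced_behead rau.
by case: u rau {IHu} => //= b u; rewrite /reduced /= => /andP[/negPf->].
Qed.

Lemma word_mulVK u w : reduced w -> word_mul (word_inv u) (word_mul u w) = w.
Proof.
move=> rw; rewrite /word_mul /word_inv.
elim: u w rw => //= a u IHu w rw; rewrite rev_cons foldr_rcons.
have := pushK (letter_inv a) (reduced_mul u rw); rewrite letter_invK => ->.
exact: IHu.
Qed.

Definition free_one := @FreeGroup [::] isT.
Definition free_mul (x y : free_group) :=
  FreeGroup (reduced_mul x (valP y)).
Definition free_inv (x : free_group) := FreeGroup (reduced_inv (valP x)).

Lemma free_mulA : associative free_mul.
Proof. by move=> x y z; apply/val_inj/word_mulA/(valP z). Qed.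

Lemma free_mul1g : left_id free_one free_mul.
Proof. by move=> x; apply/val_inj. Qed.

Lemma free_mulg1 : right_id free_one free_mul.
Proof. by move=> x; apply/val_inj/word_mulg1/(valP x). Qed.

Lemma free_mulVg : left_inverse free_one free_inv free_mul.
Proof.
move=> x; apply/val_inj => /=; rewrite -{2}(word_mulg1 (valP x)).
exact: word_mulVK.
Qed.

Lemma free_mulgV : right_inverse free_one free_inv free_mul.
Proof.
have invK x : free_inv (free_inv x) = x.
  apply/val_inj; rewrite /= /word_inv map_rev revK -map_comp map_id_in // => a.
  by rewrite /= letter_invK.
by move=> x; rewrite -{1}(invK x) free_mulVg.
Qed.

HB.instance Definition _ := isGroup.Build free_group
  free_mulA free_mul1g free_mulg1 free_mulVg free_mulgV.

Definition free_gen (x : T) : free_group := @FreeGroup [:: (x, false)] isT.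

(* The homomorphism from the free group that extends [f]. *)
Section Lift.
Variables (G : groupType) (f : T -> G).

Definition eval_letter a : G := if a.2 then (f a.1)^-1 else f a.1.
Definition free_lift (w : free_group) : G :=
  \prod_(a <- (w : seq (T * bool))) eval_letter a.

Lemma eval_letterV a : eval_letter (letter_inv a) = (eval_letter a)^-1.
Proof. by case: a => x []; rewrite /eval_letter //= invgK. Qed.

Lemma free_lift_morphism : monoid_morphism free_lift.
Proof.
split=> [|u v]; rewrite /free_lift /= ?big_nil //.
elim: (word u) => [|a w IHw]; first by rewrite big_nil mul1g.
rewrite big_cons -mulgA -{}IHw /=; case: (word_mul _ _) => [|b s] /=.
  by rewrite big_cons.
case: eqP => [->|_]; rewrite !big_cons //.
by rewrite eval_letterV mulKVg.
Qed.

HB.instance Definition _ :=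
  isUMagmaMorphism.Build free_group G free_lift free_lift_morphism.

Lemma free_lift_gen x : free_lift (free_gen x) = f x.
Proof. by rewrite /free_lift big_seq1. Qed.

End Lift.
End FreeGroup.

(* The associated group of the rack [X], with x |> y = x y x^-1. *)
Section AssociatedGroup.
Variables (G : groupType) (X : set G).

Definition rack_relators : set (free_group X) :=
  [set r | exists x y z : X,
     val z = val x * val y * (val x)^-1 /\
     r = free_gen x * free_gen y * (free_gen x)^-1 * (free_gen z)^-1].

Definition associated_group : groupType := quot_group rack_relators.

End AssociatedGroup.

Section RelativeSchurMultiplier.
Variables (G : groupType) (X : set G).
Local Notation F := (free_group X).

Definition class_pi : F -> G := free_lift (fun x : X => val x).
HB.instance Definition _ := UMagmaMorphism.copy class_pi
  (free_lift (fun x : X => val x)).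

Definition class_ker : set F := [set w | class_pi w = 1].

(* [F_X / [F_X, R_X]] *)
Definition class_cover : groupType :=
  quot_group (commutator_subgroup setT class_ker).

Definition cover_pi (h : class_cover) : G := class_pi (repr h).

(* [M(G)], as the image of [R_X `&` [F_X, F_X]] in [class_cover] *)
Definition schur_set : set class_cover :=
  [set quot_pi _ w | w in class_ker `&` commutator_subgroup setT setT].

Lemma class_ker_normal : is_normal class_ker.
Proof.
have M : {morph class_pi : u v / u * v} by exact: gmulfM.
have V : {morph class_pi : u / u^-1} by exact: gmulfV.
split; first split=> [|u v Ku Kv|u Ku]; rewrite /class_ker /=.
- exact: gmulf1.
- by rewrite M Ku Kv mulg1.
- by rewrite V Ku invg1.
- by move=> g u Ku; rewrite /class_ker /= !M V Ku mulg1 mulgV.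
Qed.

Lemma schur_set_subgroup : is_subgroup schur_set.
Proof.
have [[K1 KM KV] _] := class_ker_normal.
have [D1 DM DV] :=
  smallest_is_subgroup [set [~ a, b] | a in @setT F & b in @setT F].
split.
- by exists 1; [split|exact: gmulf1].
- move=> _ _ [u [Ku Du] <-] [v [Kv Dv] <-]; exists (u * v); last exact: gmulfM.
  by split; [exact: KM|exact: DM].
- move=> _ [u [Ku Du] <-]; exists u^-1; last exact: gmulfV.
  by split; [exact: KV|exact: DV].
Qed.

Definition schur_multiplier : groupType := subgroup_type schur_set_subgroup.

(* The graph of [mu_x]; [mu_rel_exists], [mu_rel_unique] and [mu_relM] show
   that it is a homomorphism from the centralizer of [x]. *)
Definition mu_rel (x : X) (g : G) (z : schur_multiplier) : Prop :=
  g * val x = val x * g /\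
  exists h y : class_cover,
    [/\ cover_pi h = g, cover_pi y = val x & val z = h * y * h^-1 * y^-1].

Definition mu_image (x : X) : set schur_multiplier :=
  [set z | exists g, mu_rel x g z].

Definition relative_schur_multiplier (x : X) : groupType :=
  quot_group (mu_image x).

Lemma cover_piE (w : F) : cover_pi (quot_pi _ w) = class_pi w.
Proof.
pose C : set F := commutator_subgroup setT class_ker.
have M : {morph class_pi : u v / u * v} by exact: gmulfM.
have V : {morph class_pi : u / u^-1} by exact: gmulfV.
have [sK KJ] := class_ker_normal; have [K1 KM KV] := sK.
have CK : C `<=` class_ker.
  move=> c; apply; split=> // _ [u _ [v Kv] <-].
  rewrite commgEr; apply: KM => //; rewrite conjgE mulgA.
  by have := KJ u^-1 _ (KV _ Kv); rewrite invgK.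
have /quot_piP Nw : quot_pi C (repr (quot_pi C w)) = quot_pi C w.
  exact: quot_reprK.
have : class_pi ((repr (quot_pi C w))^-1 * w) = 1.
  by apply: (Nw class_ker); split.
by rewrite /cover_pi -/C M V => /(canRL (mulVKg _)); rewrite mulg1.
Qed.

Lemma cover_piM : {morph cover_pi : h k / h * k}.
Proof.
move=> h k; rewrite -(quot_reprK h) -(quot_reprK k) -quot_piM !cover_piE.
exact: gmulfM.
Qed.

Lemma cover_piV : {morph cover_pi : h / h^-1}.
Proof.
by move=> h; rewrite -(quot_reprK h) -quot_piV !cover_piE; exact: gmulfV.
Qed.

Lemma cover_ker_central (z : class_cover) : cover_pi z = 1 -> center z.
Proof.
rewrite -(quot_reprK z) cover_piE; move: (repr z) => r Kr f.
rewrite -(quot_reprK f); move: (repr f) => {}f; rewrite -!quot_piM.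
apply/quot_piP; apply: sub_normal_closure => H [_]; apply.
by exists f => //; exists r => //; rewrite commgEl conjgE invgM !mulgA.
Qed.

Lemma schur_central (z : schur_multiplier) : center (val z).
Proof.
have := valP z; rewrite inE => -[w [Kw _] <-].
by apply: cover_ker_central; rewrite cover_piE.
Qed.

Lemma mu_rel_exists (x : X) (g : G) :
  (exists h, cover_pi h = g) -> g * val x = val x * g -> exists z, mu_rel x g z.
Proof.
move=> [h hg] gx; have [w hw] : exists w : F, h = quot_pi _ w.
  by exists (repr h); rewrite quot_reprK.
pose v := free_gen x; have vx : class_pi v = val x by exact: free_lift_gen.
have M : {morph class_pi : u v / u * v} by exact: gmulfM.
have V : {morph class_pi : u / u^-1} by exact: gmulfV.
have Sz : h * quot_pi _ v * h^-1 * (quot_pi _ v)^-1 \in schur_set.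
  rewrite inE; exists (w * v * w^-1 * v^-1); last first.
    by rewrite hw !quot_piM !quot_piV.
  split; last first.
    move=> H [_]; apply; exists w^-1 => //; exists v^-1 => //.
    by rewrite commgEl conjgE !invgK !mulgA.
  rewrite /class_ker /= !M !V vx -cover_piE -hw hg.
  by rewrite gx mulgK mulgV.
exists (@exist _ (fun t => t \in schur_set) _ Sz); split=> //.
by exists h, (quot_pi _ v); split; rewrite ?cover_piE.
Qed.

Lemma mu_rel_unique (x : X) (g : G) (z : schur_multiplier) (h y : class_cover) :
  mu_rel x g z -> cover_pi h = g -> cover_pi y = val x ->
  val z = h * y * h^-1 * y^-1.
Proof.
move=> [_ [h' [y' [h'g y'x ->]]]] hg yx.
have Ch : center (h^-1 * h').
  by apply: cover_ker_central; rewrite cover_piM cover_piV hg h'g mulVg.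
have Cy : center (y^-1 * y').
  by apply: cover_ker_central; rewrite cover_piM cover_piV yx y'x mulVg.
rewrite -(mulVKg h h') -(mulVKg y y').
move: (_ * h') Ch (_ * y') Cy => c Cc d Cd; rewrite !invgM.
have -> : h * c * (y * d) * (c^-1 * h^-1) = h * y * h^-1 * d.
  rewrite -(mulgA h) (Cc (y * d)) -!mulgA; congr (_ * (_ * _)).
  by rewrite Cd mulVKg -Cd.
by rewrite -!mulgA mulVKg.
Qed.

Lemma mu_relM (x : X) (g g' : G) (z z' : schur_multiplier) :
  mu_rel x g z -> mu_rel x g' z' -> mu_rel x (g * g') (z * z').
Proof.
move=> [gx [h [y [hg yx zE]]]] mz'; have [g'x [h' [_ [h'g' _ _]]]] := mz'.
have z'E := mu_rel_unique mz' h'g' yx.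
split; first by rewrite -mulgA g'x !mulgA gx.
exists (h * h'), y; split=> //; first by rewrite cover_piM hg h'g'.
rewrite valM zE; have Cz' := schur_central z'.
have -> : h * h' * y * (h * h')^-1 * y^-1 = h * val z' * y * h^-1 * y^-1.
  by rewrite z'E invgM !mulgA mulgVK.
by rewrite -!mulgA Cz' !mulgA.
Qed.

Lemma mu_image_normal (x : X) : is_normal (mu_image x).
Proof.
have y1 : cover_pi (quot_pi _ (free_gen x)) = val x.
  by rewrite cover_piE; exact: free_lift_gen.
have c1 : cover_pi 1 = 1.
  by apply: (mulgI (cover_pi 1)); rewrite -cover_piM !mulg1.
split; first split.
- exists 1; split; first by rewrite mul1g mulg1.
  exists 1, (quot_pi _ (free_gen x)).
  by split; rewrite ?val1 ?invg1 ?mulg1 ?mul1g ?mulgV.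
- by move=> z z' [g mz] [g' mz']; exists (g * g'); exact: mu_relM.
- move=> z [g mz]; have [gx [h [_ [hg _ _]]]] := mz.
  have gVx : g^-1 * val x = val x * g^-1.
    by apply: (mulgI g); rewrite mulVKg mulgA gx mulgK.
  have [|z' mz'] := @mu_rel_exists x g^-1 _ gVx.
    by exists h^-1; rewrite cover_piV hg.
  exists g^-1; suff -> : z^-1 = z' by [].
  have := mu_relM mz mz'; rewrite mulgV => m1.
  apply: (mulgI z); rewrite mulgV; apply/val_inj.
  by rewrite (mu_rel_unique m1 c1 y1) val1 mul1g invg1 mulg1 mulgV.
- move=> t z Iz; suff -> : t * z = z * t by rewrite mulgK.
  by apply/val_inj; rewrite !valM; apply/esym/schur_central.
Qed.

End RelativeSchurMultiplier.

Section CentralExtensions.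
Variables (E G : groupType) (p : UMagmaMorphism.type E G).

Definition is_central_extension : Prop :=
  (forall g, exists e, p e = g) /\ [set e | p e = 1] `<=` @center E.

End CentralExtensions.

Definition is_universal_central_extension (E G : groupType)
    (p : UMagmaMorphism.type E G) : Prop :=
  is_central_extension p /\
  forall (E' : groupType) (q : UMagmaMorphism.type E' G),
    is_central_extension q ->
    exists f : UMagmaMorphism.type E E',
      (forall e, q (f e) = p e) /\
      forall f' : UMagmaMorphism.type E E',
        (forall e, q (f' e) = p e) -> forall e, f' e = f e.

Definition is_central_subgroup_of_order (E : groupType) (n : nat)
    (N : set E) : Prop :=
  [/\ is_subgroup N, N `<=` @center E & (N #= `I_n)%card].

(* Meaningful for [1 < n] only: ['Z_n] is Z/2 for [n < 2]. *)
Definition cyclic_group (n : nat) : groupType := Algebra.to_multiplicative 'Z_n.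
Definition infinite_cyclic_group : groupType := Algebra.to_multiplicative int.

Definition A6 : finGroupType := subg_of ('Alt_('I_6)).

Definition points6 (s : seq nat) : seq 'I_6 := [seq inord k.-1 | k <- s].

(* The cycle [(k1 k2 ...)] of the points 1, ..., 6, where [i : 'I_6] stands for
   the point [i.+1]. *)
Definition cycle6 (s : seq nat) : {perm 'I_6} :=
  insubd (1 : {perm 'I_6}) [ffun i => next (points6 s) i].

Definition a6 (s : {perm 'I_6}) : A6 := subg 'Alt_('I_6) s.

Lemma cycle6E (s : seq nat) :
  all (fun k => 0 < k <= 6)%N s -> uniq s -> cycle6 s =1 next (points6 s).
Proof.
move=> /allP s6 us i; have us' : uniq (points6 s).
  rewrite map_inj_in_uniq // => j k /s6 /andP[j0 j6] /s6 /andP[k0 k6].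
  move=> /(congr1 val); by rewrite /= !inordK ?prednK // => jk; rewrite -(prednK j0) jk prednK.
rewrite /cycle6 -pvalE [pval _]val_insubd; case: ifP => [_|/negP[]]; first by rewrite ffunE.
apply/injectiveP => j k; rewrite !ffunE; exact: can_inj (prev_next us') _ _.
Qed.

Local Notation tp j k := (tperm (inord j.-1) (inord k.-1) : {perm 'I_6}).

Local Lemma inord6 k (h : (k < 6)%N) : inord k = Ordinal h.
Proof. by apply/val_inj; rewrite /= inordK. Qed.

Local Ltac cycle6_tperm :=
  apply/permP; (case; case=> [|[|[|[|[|[|//]]]]]] ?);
  rewrite cycle6E // ?permM /= ?(@inord6 0%N isT) ?(@inord6 1%N isT);
  rewrite ?(@inord6 2%N isT) ?(@inord6 3%N isT) ?(@inord6 4%N isT);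
  rewrite ?(@inord6 5%N isT) // !permE; apply/val_inj; by [].

(* Hence [a6] does not truncate the representatives of the classes below. *)
Lemma class_representatives_even : all (mem 'Alt_('I_6))
  [:: cycle6 [:: 1; 2; 3]%N; cycle6 [:: 1; 2; 3]%N * cycle6 [:: 4; 5; 6]%N;
      cycle6 [:: 1; 2]%N * cycle6 [:: 3; 4]%N;
      cycle6 [:: 1; 2; 3; 4]%N * cycle6 [:: 5; 6]%N;
      cycle6 [:: 1; 2; 3; 4; 5]%N; cycle6 [:: 1; 2; 3; 4; 6]%N].
Proof.
have E2 : cycle6 [:: 1; 2]%N = tp 1%N 2%N.
  by cycle6_tperm.
have E2' : cycle6 [:: 3; 4]%N = tp 3%N 4%N.
  by cycle6_tperm.
have E2'' : cycle6 [:: 5; 6]%N = tp 5%N 6%N.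
  by cycle6_tperm.
have E3 : cycle6 [:: 1; 2; 3]%N = tp 1%N 2%N * tp 1%N 3%N.
  by cycle6_tperm.
have E3' : cycle6 [:: 4; 5; 6]%N = tp 4%N 5%N * tp 4%N 6%N.
  by cycle6_tperm.
have E4 : cycle6 [:: 1; 2; 3; 4]%N = tp 1%N 2%N * tp 1%N 3%N * tp 1%N 4%N.
  by cycle6_tperm.
have E5 : cycle6 [:: 1; 2; 3; 4; 5]%N = tp 1%N 2%N * tp 1%N 3%N * tp 1%N 4%N
    * tp 1%N 5%N.
  by cycle6_tperm.
have E6 : cycle6 [:: 1; 2; 3; 4; 6]%N = tp 1%N 2%N * tp 1%N 3%N * tp 1%N 4%N
    * tp 1%N 6%N.
  by cycle6_tperm.
rewrite E2 E2' E2'' E3 E3' E4 E5 E6 /= !Alt_even !odd_permM !odd_tperm.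
have D j k : (j < 6)%N -> (k < 6)%N -> (@inord 5 j == inord k) = (j == k).
  by move=> j6 k6; rewrite -val_eqE /= !inordK.
by rewrite !D.
Qed.

Definition class_3 : set A6 := conj_class (a6 (cycle6 [:: 1; 2; 3]%N)).
Definition class_33 : set A6 :=
  conj_class (a6 (cycle6 [:: 1; 2; 3]%N * cycle6 [:: 4; 5; 6]%N)).
Definition class_22 : set A6 :=
  conj_class (a6 (cycle6 [:: 1; 2]%N * cycle6 [:: 3; 4]%N)).
Definition class_42 : set A6 :=
  conj_class (a6 (cycle6 [:: 1; 2; 3; 4]%N * cycle6 [:: 5; 6]%N)).
Definition class_5a : set A6 := conj_class (a6 (cycle6 [:: 1; 2; 3; 4; 5]%N)).
Definition class_5b : set A6 := conj_class (a6 (cycle6 [:: 1; 2; 3; 4; 6]%N)).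

(* Main.v *)
Require Import Defs.
From HB Require Import structures.
From mathcomp Require Import all_boot all_order all_algebra.
From mathcomp Require Import fingroup perm alt.
From mathcomp Require Import gseries cyclic finfield ring.
From mathcomp Require Import boolp classical_sets functions cardinality.

Local Open Scope classical_set_scope.
Local Open Scope group_scope.

Set Implicit Arguments.
Unset Strict Implicit.
Unset Printing Implicit Defensive.

(** Let p : E -> A6 be a central extension. The commutator of lifts to E of two
    commuting elements of A6 is central, depends only on these elements, and is
    multiplicative in each of them. Two such commutators carry everything:
    d, for the commuting 3-cycles (4 5 6) and (1 2 3), and t, for two
    generators of a Klein four-group. As they come from elements of order 3 and
    2, one has d^3 = t^2 = 1.

    The elements d and t generate the intersection of ker p with [E, E]
    ([commutator_kernel]). Indeed A6 is presented by the 3-cycles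
    x_i = (i 5 6), i = 1, ..., 4, with relations x_i^3 = (x_i x_j)^2 = 1
    (Carmichael; [carmichael_faithful]). Conjugation by lifts of two 3-cycles
    produces lifts X_i with X_i^3 = z and (X_i X_j)^2 = w up to powers of d,
    where z and w are central ([normalized_lifts]), and a computation in a
    central extension of A4 gives t = z^4 w^-3 ([tetrahedral_comm]). Modulo d
    and t the elements X_i z w^-1 satisfy the relations of Carmichael, so they
    generate a copy of A6 that splits the extension, and the commutator
    subgroup lies in this copy.

    Neither d nor t vanishes in general. A homomorphism from A6 to a projective
    group is given by four matrices that satisfy the relations of Carmichael up to
    scalars ([projective_extension]); four transvections of SL_2(9) show that
    t is not trivial, and four elements of SL_3(4) that permute the six points
    of a hyperoval of the projective plane show that d is not trivial. Hence in
    an extension that maps to all others, such as F_X / [F_X, R_X] or A6^*,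
    the multiplier is cyclic of order 6, generated by c = d t
    ([versal_kernel]).

    The image of mu_x consists of the commutators of a lift of x with lifts of
    elements of its centralizer, and is killed by the order of x. If x has
    order 3 it is therefore contained in <d>, if x has order 2 in <t>, and both
    bounds are attained; if x has order 5 it is trivial, and for the class of
    (1 2 3 4)(5 6) it is trivial because x generates its centralizer
    ([kappa_classes]). This gives the relative multipliers.

    The associated group As(X) is a central extension of A6 with a degree map
    to Z. The map f : A6^* -> As(X) over A6 has as kernel the image of mu_x:
    the image dies because every g in As(X) conjugates generators in the way
    its image in A6 does, and conversely g_(a x a^-1) |-> e s e^-1, with e and
    s lifts of a and x, is a well defined map from As(X) to the quotient of
    A6^* by this image ([kernel_to_associated_group]). The element
    f(s)^-1 g_x is central of degree 1 and its powers supply the factor Z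
    ([associated_group_iso]). *)

(** * Subgroups, morphisms and central elements *)

Lemma morphism_of (G H : groupType) (f : G -> H) :
  {morph f : x y / x * y} ->
  exists F : UMagmaMorphism.type G H, forall x, F x = f x.
Proof.
move=> fM; have f1 : f 1 = 1 by apply: (mulgI (f 1)); rewrite -fM !mulg1.
pose m := isUMagmaMorphism.Build G H f (conj f1 fM).
by exists (HB.pack_for (UMagmaMorphism.type G H) f m).
Qed.

Lemma iso_of (G H : groupType) (f : UMagmaMorphism.type G H) :
  (forall x, f x = 1 -> x = 1) -> (forall y, exists x, f x = y) ->
  group_iso G H.
Proof.
move=> fker fsurj; exists f; split; last exact: gmulfM.
have fI : injective f by apply: gmulf_inj.
pose g y := sval (cid (fsurj y)).
have gK : cancel g f by move=> y; exact: svalP (cid (fsurj y)).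
by exists g => // x; apply: fI; rewrite gK.
Qed.

Lemma iso_sym (G H : groupType) : group_iso G H -> group_iso H G.
Proof.
move=> [f [[g fK gK] fM]]; exists g; split; first by exists f.
by move=> x y; apply: (can_inj fK); rewrite fM !gK.
Qed.

Section Generated.
Variable G : groupType.
Implicit Types A H : set G.

Definition sgen A : set G := smallest (@is_subgroup G) A.

Lemma sgen_subgroup A : is_subgroup (sgen A).
Proof. exact: smallest_is_subgroup. Qed.

Lemma sub_sgen A : A `<=` sgen A.
Proof. by move=> x Ax H [_]; apply. Qed.

Lemma sgen_sub A H : is_subgroup H -> A `<=` H -> sgen A `<=` H.
Proof. by move=> sH AH x; apply. Qed.

Lemma sgen1 A : sgen A 1. Proof. by case: (sgen_subgroup A). Qed.
Lemma sgenM A x y : sgen A x -> sgen A y -> sgen A (x * y).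
Proof. by case: (sgen_subgroup A) => _ + _; apply. Qed.
Lemma sgenV A x : sgen A x -> sgen A x^-1.
Proof. by case: (sgen_subgroup A) => _ _; apply. Qed.

Lemma sgenS A B : A `<=` B -> sgen A `<=` sgen B.
Proof. by move=> AB; apply: sgen_sub (sgen_subgroup B) _ => x /AB; exact: sub_sgen. Qed.

Lemma centralizer_subgroup (g : G) : is_subgroup [set h | g * h = h * g].
Proof.
split=> [|u v /= Hu Hv|u /= Hu] /=; first by rewrite mulg1 mul1g.
  by rewrite mulgA Hu -mulgA Hv mulgA.
by apply: (mulgI u); rewrite mulgA -Hu mulgK mulVKg.
Qed.

Lemma center_subgroup : is_subgroup (@center G).
Proof.
split=> [g|x y Cx Cy g|x Cx g]; first by rewrite mul1g mulg1.
  by rewrite -mulgA (Cy g) mulgA (Cx g) -mulgA.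
by apply: (mulgI x); rewrite mulVKg mulgA Cx mulgK.
Qed.

Lemma center1 : @center G 1. Proof. by have [] := center_subgroup. Qed.
Lemma centerM x y : @center G x -> center y -> center (x * y).
Proof. by move=> Cx Cy; have [_ H _] := center_subgroup; exact: H. Qed.
Lemma centerV x : @center G x -> center x^-1.
Proof. by move=> Cx; have [_ _ H] := center_subgroup; exact: H. Qed.
Lemma centerX x n : @center G x -> center (x ^+ n).
Proof.
move=> Cx; elim: n => [|n IHn]; [exact: center1|rewrite expgS; exact: centerM].
Qed.

Lemma expgM_central x y n : @center G y -> (x * y) ^+ n = x ^+ n * y ^+ n.
Proof. by move=> Cy; apply: expgMn; rewrite /commute Cy. Qed.

Lemma conjg_central x y : @center G x -> x ^ y = x.
Proof. by move=> Cx; rewrite conjgE Cx mulKg. Qed.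

Lemma conjg_by_central x y : @center G y -> x ^ y = x.
Proof. by move=> Cy; rewrite conjgE -Cy mulKg. Qed.

Lemma mulgCA_central c x y : @center G c -> x * (c * y) = c * (x * y).
Proof. by move=> Cc; rewrite !mulgA Cc. Qed.

Lemma commg_mod_center a b c d : @center G c -> center d ->
  [~ a * c, b * d] = [~ a, b].
Proof.
move=> Cc Cd; rewrite !commgEl conjMg (conjg_central (b * d) Cc) conjgM
  (conjg_by_central _ Cd).
by rewrite -(Cc (a ^ b)) invgM -mulgA (mulgCA_central _ _ Cc) mulKg.
Qed.

Lemma commMg_central a a' b : @center G [~ a, b] ->
  [~ a * a', b] = [~ a, b] * [~ a', b].
Proof.
move=> Ca; rewrite [in LHS]commgEl conjMg invgM -(mulgA a'^-1).
rewrite (mulgA a^-1 (a ^ b)) -commgEl.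
by rewrite (mulgCA_central _ _ Ca) -commgEl.
Qed.

Lemma commgM_central a b b' : @center G [~ a, b] ->
  [~ a, b * b'] = [~ a, b] * [~ a, b'].
Proof.
move=> Ca; have Cb : center [~ b, a] by rewrite -invgR; apply: centerV.
rewrite -(invgR (b * b')) commMg_central // Cb -(invgR b') -(invgR b) -invgM.
by [].
Qed.

Lemma commgX_central a b n : @center G [~ a, b] -> [~ a, b ^+ n] = [~ a, b] ^+ n.
Proof.
move=> Ca; elim: n => [|n IHn]; first by rewrite !expg0 commg1.
by rewrite !expgS commgM_central // IHn.
Qed.

Lemma commXg_central a b n : @center G [~ a, b] -> [~ a ^+ n, b] = [~ a, b] ^+ n.
Proof.
move=> Ca; elim: n => [|n IHn]; first by rewrite !expg0 comm1g.
by rewrite !expgS commMg_central // IHn.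
Qed.

Lemma central_commE a b : @center G [~ a, b] -> a * b * a^-1 * b^-1 = [~ a, b].
Proof.
move: [~ a, b] (commgC a b) => c -> Cc.
by rewrite -(Cc (b * a)) -!mulgA mulVKg mulgV mulg1.
Qed.

(** The group A4 is generated by x and y subject to x^3 = y^3 = (x y)^2 = 1, and
    x y and y x generate its Klein four-group. The lemma expresses their
    commutator in a central extension through the values of the relators. Since
    (x y)^2 and (y x)^2 are central, this commutator is w^-2 (x y y x)^2. *)
Lemma tetrahedral_comm x y z w : @center G z -> @center G w ->
  x ^+ 3 = z -> y ^+ 3 = z -> (x * y) ^+ 2 = w ->
  [~ x * y, y * x] = z ^+ 4 * w ^- 3.
Proof.
move=> Cz Cw x3 y3 xy2.
have yx2 : (y * x) ^+ 2 = w.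
  rewrite -(conjg_central x Cw) -xy2 conjXg conjgE !mulgA.
  by rewrite mulVg mul1g.
have inv2 u : u ^+ 2 = w -> u^-1 = w^-1 * u.
  by move=> <-; apply: (mulIg u); rewrite mulVg -mulgA -expg2 mulVg.
have y2 : y * y = z * y^-1 by rewrite -y3 expgSr expg2 mulgK.
have x2 : x * x = z * x^-1 by rewrite -x3 expgSr expg2 mulgK.
have CwV := centerV Cw.
have yVx : y^-1 * (x^-1 * y^-1) = w^-1 * x.
  by rewrite mulgA -invgM (inv2 _ xy2) -!mulgA mulgV mulg1.
have pq : x * y * (y * x) = z * (x * (y^-1 * x)).
  by rewrite -mulgA (mulgA y) y2 -mulgA (mulgCA_central _ _ Cz).
have aa : x * (y^-1 * x) * (x * (y^-1 * x)) = z ^+ 2 * w^-1.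
  rewrite -!mulgA (mulgA x x) x2 -mulgA !(mulgCA_central _ _ Cz).
  rewrite (mulgA x^-1) (mulgA y^-1) yVx -!mulgA !(mulgCA_central _ _ CwV).
  by rewrite -expg2 -expgS x3 CwV mulgA.
have pq2 : x * y * (y * x) * (x * y * (y * x)) = z ^+ 4 * w^-1.
  by rewrite pq -mulgA (mulgCA_central _ _ Cz) aa !expgS expg0 !mulg1 !mulgA.
have -> : [~ x * y, y * x] = w^-1 * (w^-1 * (x * y * (y * x) * (x * y * (y * x)))).
  by rewrite commgEl conjgE (inv2 _ xy2) (inv2 _ yx2) -!mulgA !(mulgCA_central _ _ CwV).
rewrite pq2 -!CwV.
by rewrite -(centerV (centerX 3 Cw)) -expVgn !expgS expg0 !mulg1 !mulgA.
Qed.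

End Generated.

Section MorphismSubgroups.
Variables (G K : groupType).
Implicit Types (f : UMagmaMorphism.type G K) (A : set G).

Lemma preim_subgroup f (H : set K) : is_subgroup H -> is_subgroup [set x | H (f x)].
Proof.
move=> [H1 HM HV]; split=> [|x y Hx Hy|x Hx] /=.
- by rewrite gmulf1.
- by rewrite gmulfM; apply: HM.
- by rewrite gmulfV; apply: HV.
Qed.

Lemma image_subgroup f A : is_subgroup A -> is_subgroup [set f x | x in A].
Proof.
move=> [A1 AM AV]; split=> [|_ _ [x Ax <-] [y Ay <-]|_ [x Ax <-]].
- by exists 1; rewrite ?gmulf1.
- by exists (x * y); rewrite ?gmulfM //; exact: AM.
- by exists x^-1; rewrite ?gmulfV //; exact: AV.
Qed.

Lemma sgen_onto f (B : set K) :
  (forall b, B b -> exists x, f x = b) -> forall y, sgen B y -> exists x, f x = y.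
Proof.
move=> Bf y By; suff [x _ <-] : [set f x | x in setT] y by exists x.
apply: By; split=> [|b /Bf[x <-]]; last by exists x.
by apply: image_subgroup; split.
Qed.

Lemma sgen_eq f f' A :
  (forall a, A a -> f a = f' a) -> forall x, sgen A x -> f x = f' x.
Proof.
move=> ff'; apply: (sgen_sub (H := [set x | f x = f' x])) => //.
split=> [|u v /= fu fv|u /= fu]; first by rewrite /= !gmulf1.
  by rewrite /= !gmulfM fu fv.
by rewrite /= !gmulfV fu.
Qed.

End MorphismSubgroups.

(** * Quotients *)

Section QuotientMaps.
Variables (G : groupType).

Lemma ker_normal (H : groupType) (f : UMagmaMorphism.type G H) :
  is_normal [set x | f x = 1].
Proof.
split; first split=> [|x y /= fx fy|x /= fx]; first exact: gmulf1.
- by rewrite gmulfM fx fy mulg1.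
- by rewrite gmulfV fx invg1.
- by move=> g x /= fx; rewrite !gmulfM gmulfV fx mulg1 mulgV.
Qed.

Lemma quot_factor (H : groupType) (A : set G) (f : UMagmaMorphism.type G H) :
  (forall a, A a -> f a = 1) ->
  exists F : UMagmaMorphism.type (quot_group A) H,
    forall x, F (quot_pi A x) = f x.
Proof.
move=> fA.
have Fpi x : f (generic_quotient.repr (quot_pi A x)) = f x.
  have /quot_piP Nx := quot_reprK (quot_pi A x).
  have : f ((generic_quotient.repr (quot_pi A x))^-1 * x) = 1.
    by apply: (Nx [set x | f x = 1]); split=> //; exact: ker_normal.
  by rewrite gmulfM gmulfV => /(canRL (mulVKg _)); rewrite mulg1.
have [|F FE] := @morphism_of _ _ (fun q : quot_group A => f (generic_quotient.repr q)).
  move=> a b; rewrite -(quot_reprK a) -(quot_reprK b) -quot_piM !Fpi.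
  exact: gmulfM.
by exists F => x; rewrite FE Fpi.
Qed.

Lemma quot_pi_surj (A : set G) (q : quot_group A) : exists x, quot_pi A x = q.
Proof. by exists (generic_quotient.repr q); exact: quot_reprK. Qed.

Lemma quot_pi_eq1 (A : set G) x :
  is_normal A -> quot_pi A x = 1 <-> A x.
Proof.
move=> nA; have -> : 1 = quot_pi A 1 by rewrite gmulf1.
by rewrite quot_piP normal_closure_id // mulg1; case: nA => -[_ _ HV] _; split=> /HV;
  rewrite ?invgK.
Qed.

Lemma central_normal (N : set G) :
  is_subgroup N -> N `<=` @center G -> is_normal N.
Proof. by move=> sN NC; split=> // g x Nx; rewrite -(NC _ Nx) mulgK. Qed.

End QuotientMaps.

(** * Coset enumeration for Carmichael's presentation *)

Section Carmichael.
Variable G : groupType.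
Implicit Types (xs : set G) (x y g h : G).

Definition generator_cosets xs y : set G :=
  [set g | exists h r,
    [/\ sgen xs h,
        [\/ r = 1, r = y, r = y^-1 | exists2 x, xs x & r = y^-1 * x]
      & g = h * r]].

Lemma invg_order2 u : u ^+ 2 = 1 -> u^-1 = u :> G.
Proof. by rewrite expg2 => uu; apply: (mulgI u); rewrite mulgV. Qed.

Lemma invg_order3 u : u ^+ 3 = 1 -> u^-1 = u * u :> G.
Proof. by rewrite !expgS expg0 mulg1 => uuu; apply: (mulgI u); rewrite mulgV. Qed.

(** The relations allow one to push every generator through the right cosets of
    the subgroup generated by xs, so that the listed cosets are permuted by
    right multiplication. In A_(n+2) these are the n + 2 cosets of the
    stabilizer A_(n+1) of a point. *)
Lemma sgen_sub_cosets xs y :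
  y ^+ 3 = 1 -> (forall x, xs x -> x ^+ 3 = 1) ->
  (forall x, xs x -> (x * y) ^+ 2 = 1) ->
  (forall x x', xs x -> xs x' -> x = x' \/ (x * x') ^+ 2 = 1) ->
  sgen (xs `|` [set y]) `<=` generator_cosets xs y.
Proof.
move=> y3 x3 xy xx g Hg; set T := generator_cosets xs y.
have gx x : xs x -> sgen xs x by move=> Xx; apply: sub_sgen.
have xyE x : xs x -> x * y = y^-1 * x^-1.
  by move=> /xy/invg_order2; rewrite invgM.
have yVV : y^-1 * y^-1 = y by rewrite -invgM -(invg_order3 y3) invgK.
have yxE x : xs x -> y * x = x^-1 * y^-1.
  move=> Xx; apply: (mulgI x); rewrite mulVKg mulgA (xyE _ Xx).
  by rewrite -!mulgA mulVg mulg1.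
have yxV x : xs x -> y * x^-1 = x^-1 * (y^-1 * x).
  by move=> Xx; rewrite [in LHS](invg_order3 (x3 _ Xx)) mulgA yxE // -mulgA.
have TM h r : sgen xs h -> T r -> T (h * r).
  move=> Gh [h' [r' [Gh' Dr' ->]]]; exists (h * h'), r'.
  by split=> //; [exact: sgenM | by rewrite mulgA].
have T1 : T 1 by exists 1, 1; split; [exact: sgen1 | by constructor | by rewrite mulg1].
have Ty : T y.
  by exists 1, y; split; [exact: sgen1 | by constructor | by rewrite mul1g].
have TyV : T y^-1.
  by exists 1, y^-1; split; [exact: sgen1 | by constructor | by rewrite mul1g].
have TyVx x : xs x -> T (y^-1 * x).
  move=> Xx; exists 1, (y^-1 * x).
  by split; [exact: sgen1 | constructor 4; exists x | rewrite mul1g].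
have TG h : sgen xs h -> T h by move=> Gh; rewrite -(mulg1 h); exact: TM.
have Tstep s a : (xs `|` [set y]) s -> T a -> T (a * s).
  move=> Ss [h [r [Gh Dr ->]]]; rewrite -mulgA; apply: (TM) => //; clear h Gh.
  case: Ss => [Xs | ->]; case: Dr => [->|->|->|[x Xx ->]].
  - by rewrite mul1g; exact: (TG _ (gx _ Xs)).
  - by rewrite (yxE _ Xs); exact: (TM _ _ (sgenV (gx _ Xs)) TyV).
  - exact: TyVx.
  - case: (xx _ _ Xx Xs) => [<-|/invg_order2 xs2].
      rewrite -mulgA -(invg_order3 (x3 _ Xx)) -(xyE _ Xx).
      exact: (TM _ _ (gx _ Xx) Ty).
    rewrite -mulgA -xs2 invgM mulgA -(xyE _ Xs) -mulgA (yxV _ Xx).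
    exact: (TM _ _ (gx _ Xs) (TM _ _ (sgenV (gx _ Xx)) (TyVx _ Xx))).
  - by rewrite mul1g.
  - by rewrite -(invg_order3 y3).
  - by rewrite mulVg.
  - rewrite -mulgA (xyE _ Xx) mulgA yVV (yxV _ Xx).
    exact: (TM _ _ (sgenV (gx _ Xx)) (TyVx _ Xx)).
have s3 s : (xs `|` [set y]) s -> s * s * s = 1.
  by move=> [/x3|->]; [| move: y3]; rewrite !expgS expg0 mulg1 mulgA.
suff : forall a, T a <-> T (a * g) by move=> /(_ 1)[/(_ T1)]; rewrite mul1g.
move: g Hg; apply: sgen_sub => [|s Ss a]; last first.
  split=> [|Tas]; first exact: (Tstep).
  by rewrite -(mulg1 a) -(s3 _ Ss) !mulgA; apply: (Tstep) => //; exact: Tstep.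
split=> [a|u v Hu Hv a|u Hu a]; first by rewrite mulg1.
  by rewrite mulgA (Hu a); exact: Hv.
by rewrite (Hu (a * u^-1)) mulgVK.
Qed.

(** The coset representatives other than 1 move the point a, so an element
    that fixes a is in the subgroup generated by xs. Iterating this for the
    points a of A6 reduces the word problem of the presentation to the
    trivial group. *)
Lemma coset_stabilizer (T : Type) (act : G -> T -> T) xs y (a b c : T) g :
  (forall g h i, act (g * h) i = act h (act g i)) ->
  (forall i, act 1 i = i) ->
  act y a = b -> act y b = c -> act y c = a -> b <> a -> c <> a ->
  (forall x, xs x -> act x a = a) ->
  generator_cosets xs y g -> act g a = a -> sgen xs g.
Proof.
move=> actM act1 yab ybc yca ba ca xa [h [r [Gh Dr ->]]].
have actV u i : act u^-1 (act u i) = i by rewrite -actM mulgV.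
have ha : act h a = a.
  apply: (Gh [set u | act u a = a]); split=> //.
  split=> [|u v /= ua va|u /= ua]; first exact: act1.
    by rewrite /= actM ua.
  by rewrite /= -{1}ua actV.
rewrite actM ha; case: Dr => [->|->|->|[x Xx ->]].
- by rewrite mulg1.
- by rewrite yab => /ba.
- by rewrite -{1}yca actV => /ca.
- by rewrite actM -{1}yca actV => /(congr1 (act x^-1));
    rewrite actV -{1}(xa _ Xx) actV => /ca.
Qed.

End Carmichael.

(** * The alternating group on six points *)

Section SixPoints.

(** The six points are numbered 0, ..., 5 here, so that the point written k in a
    cycle such as (1 2 3) is [o (k - 1)]. *)
Definition o (k : nat) : 'I_6 := inord k.

Lemma eq_o j k : (j < 6)%N -> (k < 6)%N -> (o j == o k) = (j == k).
Proof. by move=> j6 k6; rewrite -val_eqE /= !inordK. Qed.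

Lemma o_surj i : exists2 k, (k < 6)%N & i = o k.
Proof. exists (val i); [exact: ltn_ord | by apply/val_inj; rewrite /= inordK]. Qed.

Definition pt (g : A6) (i : 'I_6) : 'I_6 := sgval g i.

Lemma ptM g h i : pt (g * h) i = pt h (pt g i).
Proof. by rewrite /pt /= permM. Qed.

Lemma pt1 i : pt 1 i = i.
Proof. by rewrite /pt /= perm1. Qed.

Lemma ptVK g i : pt g^-1 (pt g i) = i.
Proof. by rewrite -ptM mulgV pt1. Qed.

Lemma pt_inj g : injective (pt g).
Proof. exact: perm_inj. Qed.

Lemma ptP (g h : A6) : (forall i, pt g i = pt h i) -> g = h.
Proof. by move=> gh; apply/val_inj/permP. Qed.

Lemma pt_eq (g h : A6) : (forall k, (k < 6)%N -> pt g (o k) = pt h (o k)) -> g = h.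
Proof. by move=> gh; apply: ptP => i; have [k k6 ->] := o_surj i; exact: gh. Qed.

Lemma sgval_a6 s : s \in 'Alt_('I_6) -> sgval (a6 s) = s.
Proof. exact: subgK. Qed.

Lemma a6_sgval g : a6 (sgval g) = g.
Proof. exact: sgvalK. Qed.

Definition cyc3 (a b c : 'I_6) : A6 := a6 (tperm a b * tperm a c).

Lemma sgval_cyc3 a b c : a != b -> a != c ->
  sgval (cyc3 a b c) = tperm a b * tperm a c.
Proof. by move=> ab ac; rewrite sgval_a6 // Alt_even odd_permM !odd_tperm ab ac. Qed.

Lemma pt_cyc3 a b c i : a != b -> a != c -> b != c ->
  pt (cyc3 a b c) i =
    if i == a then b else if i == b then c else if i == c then a else i.
Proof.
move=> ab ac bc; rewrite /pt sgval_cyc3 // permM.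
case: (i =P a) => [->|ia]; first by rewrite tpermL tpermD // eq_sym.
case: (i =P b) => [->|ib]; first by rewrite tpermR tpermL.
case: (i =P c) => [->|ic]; first by rewrite (tpermD ac bc) tpermR.
by rewrite !(@tpermD _ _ _ i) // eq_sym; apply/eqP.
Qed.

Lemma cyc3J a b c g : a != b -> a != c ->
  cyc3 a b c ^ g = cyc3 (pt g a) (pt g b) (pt g c).
Proof.
move=> ab ac; apply/val_inj.
change (sgval (cyc3 a b c ^ g) = sgval (cyc3 (pt g a) (pt g b) (pt g c))).
rewrite sgval_cyc3 ?(inj_eq (@pt_inj g)) //.
have -> : sgval (cyc3 a b c ^ g) = sgval (cyc3 a b c) ^ sgval g by [].
by rewrite sgval_cyc3 // conjMg !tpermJ.
Qed.

(** Only the transposition of 4 and 5 and the identity fix 0, ..., 3. *)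
Lemma even_fix4 g : (forall k, (k < 4)%N -> pt g (o k) = o k) -> g = 1.
Proof.
move=> gk.
have g45 k : (4 <= k < 6)%N -> pt g (o k) = o 4 \/ pt g (o k) = o 5.
  move=> /andP[k4 k6]; have [l l6 gl] := o_surj (pt g (o k)).
  have [l4|] := ltnP l 4.
    by move: gl; rewrite -(gk _ l4) => /pt_inj/eqP; rewrite eq_o // => /eqP kl;
      move: l4; rewrite -kl ltnNge k4.
  by case: l l6 gl => [|[|[|[|[|[|]]]]]] //; auto.
have o45 : o 4 != o 5 by rewrite eq_o.
case: (g45 4%N isT) => g4; case: (g45 5%N isT) => g5.
- by case/eqP: o45; apply: (@pt_inj g); rewrite g4 g5.
- by apply: pt_eq => -[|[|[|[|[|[|]]]]]] // _; rewrite pt1; first [exact: gk|done].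
- have gE : sgval g = tperm (o 4) (o 5).
    apply/permP => i; have [k k6 ->] := o_surj i.
    have [k4|] := ltnP k 4; first by rewrite -/(pt g _) gk // tpermD ?eq_o //;
      case: k k4 {k6} => [|[|[|[|]]]].
    by case: k k6 => [|[|[|[|[|[|]]]]]] // _ _; rewrite ?tpermL ?tpermR.
  have : sgval g \in 'Alt_('I_6) by exact: subgP.
  by rewrite gE Alt_even odd_tperm o45.
- by case/eqP: o45; apply: (@pt_inj g); rewrite g4 g5.
Qed.

(** Carmichael's generators, for i < 4. *)
Definition x_ (i : nat) : A6 := cyc3 (o i) (o 4) (o 5).

Lemma pt_x i k : (i < 4)%N -> (k < 6)%N ->
  pt (x_ i) (o k) =
    o (if k == i then 4 else if k == 4 then 5 else if k == 5 then i else k)%N.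
Proof.
move=> i4 k6; have i6 : (i < 6)%N by exact: ltn_trans i4 _.
rewrite pt_cyc3 ?eq_o //; try by case: i i4 {i6} => [|[|[|[|]]]].
by do !case: ifP => //.
Qed.

Definition first_gens (G : groupType) (Y : nat -> G) n : set G :=
  [set y | exists2 i, (i < n)%N & y = Y i].

Lemma first_gensS (G : groupType) (Y : nat -> G) n :
  first_gens Y n.+1 = first_gens Y n `|` [set Y n].
Proof.
apply/seteqP; split=> y.
  move=> [i]; rewrite ltnS leq_eqVlt => /orP[/eqP->|i_n] ->; first by right.
  by left; exists i.
by case=> [[i i_n ->]|->]; [exists i; rewrite // ltnW|exists n].
Qed.

(** Carmichael's presentation of A6: a group generated by elements that satisfy
    the relations and map to the 3-cycles x_i maps injectively to A6. *)
Lemma carmichael_faithful (G : groupType) (p : UMagmaMorphism.type G A6)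
    (Y : nat -> G) :
  (forall i, (i < 4)%N -> p (Y i) = x_ i) ->
  (forall i, (i < 4)%N -> Y i ^+ 3 = 1) ->
  (forall i j, (i < j < 4)%N -> (Y i * Y j) ^+ 2 = 1) ->
  forall g, sgen (first_gens Y 4) g -> p g = 1 -> g = 1.
Proof.
move=> pY Y3 Y2 g.
have Y2' i j : (i < 4)%N -> (j < 4)%N -> i != j -> (Y i * Y j) ^+ 2 = 1.
  move=> i4 j4; rewrite neq_ltn => /orP[ij|ji]; first by rewrite Y2 // ij.
  have := Y2 _ _ (introT andP (conj ji i4)); rewrite !expg2 =>
    /(congr1 (conjg^~ (Y j))).
  by rewrite conj1g conjgE -!mulgA mulKg.
have: (4 <= 4)%N by []; move: {-2}4%N g; elim=> [|n IHn] g n4 Sg pg.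
  have : sgen set0 g by apply: sgenS Sg => y [i].
  by apply: (sgen_sub (H := [set 1])) => //; split=> [|x y /= -> ->|x /= ->];
    rewrite ?mulg1 ?invg1.
apply: IHn (pg) => //; first exact: ltnW.
have n6 : (n < 6)%N by exact: leq_trans n4 _.
have ne k : (n < k < 6)%N -> o k <> o n.
  by move=> /andP[nk k6] /eqP; rewrite eq_o // => /eqP E; rewrite E ltnn in nk.
apply: (@coset_stabilizer _ _ (fun g => pt (p g)) (first_gens Y n) (Y n) (o n) (o 4)
  (o 5)) => //.
- by move=> a b i; rewrite gmulfM ptM.
- by move=> i; rewrite gmulf1 pt1.
- by rewrite pY // pt_x // eqxx.
- by rewrite pY // pt_x //; case: (n) n4 => [|[|[|[|]]]].
- by rewrite pY // pt_x //; case: (n) n4 => [|[|[|[|]]]].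
- by apply: ne; rewrite n4.
- by apply: ne; rewrite (leq_trans n4).
- move=> _ [i i_n ->]; have i4 := leq_trans i_n (ltnW n4).
  rewrite pY // pt_x //; congr o.
  by case: (n) (i) n4 i_n {i4 n6 ne} => [|[|[|[|]]]] // [|[|[|[|]]]].
- apply: sgen_sub_cosets; last by rewrite -first_gensS.
  + exact: Y3.
  + by move=> _ [i i_n ->]; apply/Y3/(leq_trans i_n)/ltnW.
  + by move=> _ [i i_n ->]; apply: Y2; rewrite i_n.
  + move=> _ _ [i i_n ->] [j j_n ->]; have [->|ij] := eqVneq i j; first by left.
    by right; apply: Y2' => //; [apply: leq_trans i_n (ltnW n4) | apply: leq_trans j_n
      (ltnW n4)].
- by rewrite pg pt1.
Qed.

(** The subgroup generated by the first n generators is the stabilizer of the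
    points n, ..., 3: it moves the point n - 1 to every point outside
    {n, ..., 3}, so one corrects the images of these points one at a time. *)
Lemma x_generate g : sgen (first_gens x_ 4) g.
Proof.
have fixS n h k : (n <= k < 4)%N -> sgen (first_gens x_ n) h -> pt h (o k) = o k.
  move=> /andP[nk k4]; move: h; apply: sgen_sub.
    split=> [|u v /= uk vk|u /= uk]; first exact: pt1; first by rewrite ptM uk.
    by rewrite -{1}uk ptVK.
  move=> _ [i i_n ->] /=; rewrite pt_x //; last exact: leq_trans k4 _.
    by case: (k) k4 nk => [|[|[|[|]]]] //; move: i_n;
      case: (n) (i) => [|[|[|[|]]]] // [|[|[|[|]]]].
  exact: leq_trans i_n (leq_trans nk (ltnW k4)).
suff H n : (n <= 4)%N -> forall g, (forall k, (n <= k < 4)%N -> pt g (o k) = o k) ->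
    sgen (first_gens x_ n) g.
  by apply: H => // k /andP[k4]; rewrite ltnNge k4.
elim: n => [|n IHn] n4 {}g gk; first by rewrite (even_fix4 gk); exact: sgen1.
have xS i : (i < n.+1)%N -> sgen (first_gens x_ n.+1) (x_ i).
  by move=> i_n; apply: sub_sgen; exists i.
suff [r Sr rn] : exists2 r, sgen (first_gens x_ n.+1) r & pt r (o n) = pt g (o n).
  rewrite -(mulgVK r g); apply: sgenM => //.
  apply: (@sgenS _ (first_gens x_ n)); first by rewrite first_gensS; left.
  apply: IHn => [|k /andP[]]; first exact: ltnW.
  rewrite leq_eqVlt => /orP[/eqP<- _|nk k4].
    by rewrite ptM -rn ptVK.
  by rewrite ptM gk ?nk // (fixS n.+1) ?nk //; exact: sgenV.
have [k k6 gn] := o_surj (pt g (o n)); rewrite gn.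
have n6 : (n < 6)%N by exact: leq_trans n4 _.
have xn : pt (x_ n) (o n) = o 4 by rewrite pt_x // eqxx.
have x5 i : (i < 4)%N -> pt (x_ i) (o 5) = o i.
  by move=> i4; rewrite pt_x //; case: i i4 => [|[|[|[|]]]].
have x4 : pt (x_ n) (o 4) = o 5 by rewrite pt_x //; case: (n) n4 => [|[|[|[|]]]].
have xnV : pt (x_ n)^-1 (o n) = o 5 by rewrite -(x5 n) // ptVK.
have [kn|nk|kn] := ltngtP k n.
- exists ((x_ n)^-1 * x_ k); last by rewrite ptM xnV x5 // (ltn_trans kn).
  by apply: sgenM; [apply: sgenV|]; apply: xS => //; exact: ltnW.
- have [k4|] := ltnP k 4.
    have /pt_inj/eqP : pt g (o k) = pt g (o n) by rewrite gn gk // nk k4.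
    by rewrite eq_o // => /eqP kn; move: nk; rewrite kn ltnn.
  case: k k6 gn nk => [|[|[|[|[|[|]]]]]] // _ _ _ _; first by exists (x_ n) => //;
    exact: xS.
  by exists (x_ n)^-1 => //; apply: sgenV; exact: xS.
- by exists 1; rewrite ?pt1 ?kn //; exact: sgen1.
Qed.

(** A permutation that commutes with every x_i with i != k permutes their
    common fixed points, and k is the only one. *)
Lemma A6_center (g : A6) : center g -> g = 1.
Proof.
move=> Cg; have fixed i a : (i < 4)%N -> pt (x_ i) a = a -> pt (x_ i) (pt g a) = pt g a.
  by move=> i4 xa; rewrite -ptM Cg ptM xa.
have gk k : (k < 4)%N -> pt g (o k) = o k.
  move=> k4; have [l l6 gl] := o_surj (pt g (o k)).
  have {}fixed i : (i < 4)%N -> i != k -> pt (x_ i) (o l) = o l.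
    move=> i4 ik; rewrite -gl; apply: fixed => //; rewrite pt_x //;
      last exact: leq_trans k4 _.
    by case: (i) (k) i4 k4 ik => [|[|[|[|]]]] // [|[|[|[|]]]].
  rewrite gl; apply/eqP; rewrite eq_o //; last exact: leq_trans k4 _.
  have F i : (i < 4)%N -> i != k -> (if l == i then 4 else if l == 4 then 5 else if l
    == 5 then i else l)%N == l.
    move=> i4 ik; have := fixed _ i4 ik; rewrite pt_x // => /eqP; rewrite eq_o //.
    by do !case: ifP => //; rewrite (leq_trans i4).
  move: {gl fixed} (F 0%N) (F 1%N) (F 2%N) (F 3%N).
  by case: l l6 {F} => [|[|[|[|[|[|]]]]]] // _;
    case: k k4 => [|[|[|[|]]]] //= _ f0 f1 f2 f3;
     do ?[by have := f0 isT isT|by have := f1 isT isT|by have := f2 isT isT|by have :=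
       f3 isT isT].
exact: even_fix4.
Qed.

End SixPoints.

(** * Commutators of lifts in central extensions *)

Section CentralExtension.
Variables (E G : groupType) (p : UMagmaMorphism.type E G).
Hypothesis cp : is_central_extension p.

Lemma ext_lift g : exists e, p e = g. Proof. by case: cp. Qed.

Lemma ker_center e : p e = 1 -> center e.
Proof. by case: cp => _; apply. Qed.

Lemma eq_mod_center a a' : p a = p a' -> exists2 c, center c & a' = a * c.
Proof.
move=> aa'; exists (a^-1 * a'); last by rewrite mulVKg.
by apply: ker_center; rewrite gmulfM gmulfV aa' mulVg.
Qed.

Lemma comm_lift a b a' b' : p a = p a' -> p b = p b' -> [~ a, b] = [~ a', b'].
Proof.
by move=> /eq_mod_center[c Cc ->] /eq_mod_center[d Cd ->]; rewrite commg_mod_center.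
Qed.

Lemma comm_center a b : commute (p a) (p b) -> center [~ a, b].
Proof. by move=> ab; apply: ker_center; rewrite gmulfR; apply/eqP/commgP. Qed.

Lemma comm_torsion a b n : commute (p a) (p b) -> p b ^+ n = 1 ->
  [~ a, b] ^+ n = 1.
Proof.
move=> ab bn; rewrite -commgX_central; last exact: comm_center.
apply/eqP/commgP; rewrite /commute; symmetry.
by apply: ker_center; rewrite gmulfXn.
Qed.

Lemma comm_conj a b h : commute (p a) (p b) -> [~ a ^ h, b ^ h] = [~ a, b].
Proof. by move=> ab; rewrite -conjRg conjg_central //; exact: comm_center. Qed.

End CentralExtension.

(** Conjugation by g012 permutes x_0, x_1, x_2 cyclically and fixes x_3;
    conjugation by g123 permutes x_1, x_2, x_3 cyclically. *)
Definition g012 : A6 := cyc3 (o 0) (o 1) (o 2).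
Definition g123 : A6 := cyc3 (o 1) (o 2) (o 3).

Lemma pt_g012 k : (k < 6)%N ->
  pt g012 (o k) =
    o (if k == 0 then 1 else if k == 1 then 2 else if k == 2 then 0 else k)%N.
Proof. by move=> k6; rewrite pt_cyc3 ?eq_o //; case: k k6 => [|[|[|[|[|[|]]]]]]. Qed.

Lemma pt_g123 k : (k < 6)%N ->
  pt g123 (o k) =
    o (if k == 1 then 2 else if k == 2 then 3 else if k == 3 then 1 else k)%N.
Proof. by move=> k6; rewrite pt_cyc3 ?eq_o //; case: k k6 => [|[|[|[|[|[|]]]]]]. Qed.

Lemma x_conj i j g : (i < 4)%N -> pt g (o i) = o j -> pt g (o 4) = o 4 ->
  pt g (o 5) = o 5 ->
  x_ i ^ g = x_ j.
Proof.
by move=> i4 gi g4 g5; rewrite cyc3J ?gi ?g4 ?g5 ?eq_o //;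
  case: i i4 gi => [|[|[|[|]]]].
Qed.

Lemma x_cube i : (i < 4)%N -> x_ i ^+ 3 = 1.
Proof.
move=> i4; apply: pt_eq => k k6; rewrite !expgS expg0 mulg1 pt1 !ptM.
by move: i k i4 k6; do 4?[case=> [|]]; do 6?[case=> [|]]; move=> //= _ _; rewrite !pt_x.
Qed.

Lemma x_mul2 i j : (i < 4)%N -> (j < 4)%N -> i != j -> (x_ i * x_ j) ^+ 2 = 1.
Proof.
move=> i4 j4 ij; apply: pt_eq => k k6; rewrite expg2 pt1 !ptM.
by move: i j k i4 j4 ij k6; do 4?[case=> [|]]; do 4?[case=> [|]]; move=> //;
  do 6?[case=> [|]];
  move=> //= _ _ _ _; rewrite !pt_x.
Qed.

Lemma g012_cube : g012 ^+ 3 = 1.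
Proof.
by apply: pt_eq; do 6?[case=> [|]]; move=> //= _;
  rewrite !expgS expg0 mulg1 pt1 !ptM !pt_g012.
Qed.

Lemma x3_g012_commute : commute (x_ 3) g012.
Proof.
by rewrite /commute; apply: pt_eq; do 6?[case=> [|]]; move=> //= _;
  rewrite !ptM pt_g012 // !pt_x // !pt_g012.
Qed.

Section CentralExtensionA6.
Variables (E : groupType) (p : UMagmaMorphism.type E A6).
Hypothesis cp : is_central_extension p.

(** The lifts X_0, X_1, X_2 are conjugate under a lift g of g012, whose cube is
    central, so g permutes them cyclically and their cubes and pairwise products
    agree. The lift X_3 is obtained from X_2 by a lift h of g123, corrected by
    the central element e of order 3 that measures the failure of h to map
    X_1 to X_2; with this correction (X_2 X_3)^2 = w. Conjugating this
    equation by g, where X_3^g = X_3 d, yields the two other products. *)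
Lemma normalized_lifts : exists (X : nat -> E) (g z w : E),
  let d := [~ X 3%N, g] in
  [/\ forall i, (i < 4)%N -> p (X i) = x_ i, p g = g012,
      center z /\ center w,
      forall i, (i < 4)%N -> X i ^+ 3 = z &
      forall i j, (i < j < 4)%N ->
        (X i * X j) ^+ 2 = w * d ^+ (if j == 3 then i.+1 %% 3 else 0)%N].
Proof.
have [g pg] := ext_lift cp g012; have [h ph] := ext_lift cp g123.
have [X0 pX0] := ext_lift cp (x_ 0).
have pJ u v : p (u ^ v) = p u ^ p v by rewrite gmulfJ.
pose X1 := X0 ^ g; pose X2 := X1 ^ g; pose X3' := X2 ^ h.
have pX1 : p X1 = x_ 1 by rewrite pJ pX0 pg; apply: x_conj; rewrite ?pt_g012.
have pX2 : p X2 = x_ 2 by rewrite pJ pX1 pg; apply: x_conj; rewrite ?pt_g012.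
have pX3' : p X3' = x_ 3 by rewrite pJ pX2 ph; apply: x_conj; rewrite ?pt_g123.
have X2g : X2 ^ g = X0.
  rewrite -!conjgM; apply: conjg_by_central; apply: ker_center cp _ _.
  by rewrite !gmulfM pg -g012_cube !expgS expg0 mulg1.
pose e := X2^-1 * X1 ^ h.
have pe : p e = 1.
  rewrite gmulfM gmulfV pX2 pJ pX1 ph (_ : x_ 1 ^ _ = x_ 2) ?mulVg //.
  by apply: x_conj; rewrite ?pt_g123.
have Ce : center e := ker_center cp pe.
have X1h : X1 ^ h = X2 * e by rewrite mulVKg.
pose z := X0 ^+ 3; pose w := (X0 * X1) ^+ 2.
have Cz : center z by apply: (ker_center cp); rewrite gmulfXn pX0 x_cube.
have Cw : center w by apply: (ker_center cp); rewrite gmulfXn gmulfM pX0 pX1 x_mul2.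
have z1 : X1 ^+ 3 = z by rewrite -conjXg conjg_central.
have z2 : X2 ^+ 3 = z by rewrite -conjXg z1 conjg_central.
have z3 : X3' ^+ 3 = z by rewrite -conjXg z2 conjg_central.
have e3 : e ^+ 3 = 1.
  apply: (mulgI z); rewrite mulg1 -{1}z2 -expgM_central // -X1h -conjXg z1.
  exact: conjg_central.
have w12 : (X1 * X2) ^+ 2 = w by rewrite -conjMg -conjXg conjg_central.
have w02 : (X0 * X2) ^+ 2 = w.
  have w20 : (X2 * X0) ^+ 2 = w by rewrite -{1}X2g -conjMg -conjXg w12 conjg_central.
  have -> : X0 * X2 = (X2 * X0) ^ X2 by rewrite conjgE -mulgA mulKg.
  by rewrite -conjXg w20 conjg_central.
have w23' : (X2 * X3') ^+ 2 * e ^+ 2 = w.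
  rewrite -expgM_central // -mulgA -Ce mulgA -X1h -conjMg -conjXg w12.
  exact: conjg_central.
pose X3 := X3' * e; pose d := [~ X3, g].
have pX3 : p X3 = x_ 3 by rewrite gmulfM pe mulg1.
have c3g : commute (p X3) (p g) by rewrite pX3 pg; exact: x3_g012_commute.
have Cd : center d := comm_center cp c3g.
have d3 : d ^+ 3 = 1 by apply: (comm_torsion cp c3g); rewrite pg g012_cube.
have X3g : X3 ^ g = X3 * d by rewrite /d commgEl mulVKg.
have w23 : (X2 * X3) ^+ 2 = w by rewrite mulgA expgM_central.
have w03 : (X0 * X3) ^+ 2 = w * d.
  have : (X0 * X3) ^+ 2 * d ^+ 2 = w.
    rewrite -expgM_central // -mulgA -X3g -X2g -conjMg -conjXg w23.
    exact: conjg_central.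
  move=> <-; by rewrite -mulgA -expgSr d3 mulg1.
have w13 : (X1 * X3) ^+ 2 = w * d ^+ 2.
  have : (X1 * X3) ^+ 2 * d ^+ 2 = w * d.
    rewrite -expgM_central // -mulgA -X3g -conjMg -conjXg w03.
    by apply: conjg_central; apply: centerM.
  move=> E1; by rewrite (expg2 d) (mulgA w) -E1 -[RHS]mulgA -expgSr d3 mulg1.
exists (fun i => nth 1 [:: X0; X1; X2; X3] i), g, z, w; rewrite /= -/d.
split=> //.
- by do 4?[case=> [|]].
- by do 4?[case=> [|]] => //= _; rewrite expgM_central // z3 e3 mulg1.
move=> i j /andP[]; case: i => [|[|[|[|i]]]]; case: j => [|[|[|[|j]]]] //= _ _;
  first [exact: w03|exact: w13|by rewrite [RHS]mulg1].
Qed.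

End CentralExtensionA6.

(** * The commutator subgroup meets the kernel in <d, t> *)

Lemma invg_torsion (G : groupType) (x : G) n i : x ^+ n.+1 = 1 ->
  (x ^+ i)^-1 = x ^+ (n * i).
Proof.
move=> xn; apply: (mulgI (x ^+ i)); rewrite mulgV -expgnDr -mulSn.
by rewrite expgnA xn expg1n.
Qed.

Lemma monomials_subgroup (G : groupType) (d t : G) m n :
  d ^+ m.+1 = 1 -> t ^+ n.+1 = 1 -> @center G d ->
  is_subgroup [set e | exists i j, e = d ^+ i * t ^+ j].
Proof.
move=> dm tn Cd; have Cdi i : center (d ^+ i) := centerX i Cd.
split=> [|_ _ [i [j ->]] [i' [j' ->]]|_ [i [j ->]]].
- by exists 0%N, 0%N; rewrite mulg1.
- exists (i + i')%N, (j + j')%N; rewrite !expgnDr -!mulgA; congr (_ * _).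
  by rewrite (mulgCA_central _ _ (Cdi i')).
- exists (m * i)%N, (n * j)%N.
  by rewrite invgM (invg_torsion _ dm) (invg_torsion _ tn) Cdi.
Qed.

(** A commutator is insensitive to central factors. *)
Lemma derived_generated (E : groupType) (S : set E) : is_subgroup S ->
  (forall e, exists s k, [/\ S s, center k & e = s * k]) ->
  commutator_subgroup setT setT `<=` S.
Proof.
move=> sS SC; apply: sgen_sub => // _ [a _ [b _ <-]].
have [s [k [Ss Ck ->]]] := SC a; have [s' [k' [Ss' Ck' ->]]] := SC b.
rewrite commg_mod_center //; have [_ SM SV] := sS.
by rewrite commgEl conjgE; apply: (SM); [exact: SV | apply: (SM);
  [exact: SV | exact: SM]].
Qed.

Lemma four_group_commute : commute (x_ 0 * x_ 1) (x_ 1 * x_ 0).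
Proof.
apply/commgP/eqP.
rewrite (tetrahedral_comm (@center1 _) (@center1 _) (@x_cube 0 isT) (@x_cube 1 isT)) //.
  by rewrite !expg1n mulgV.
exact: x_mul2.
Qed.

Section CommutatorKernel.
Variables (E : groupType) (p : UMagmaMorphism.type E A6).
Hypothesis cp : is_central_extension p.

(** Modulo N = <d, t> the lifts X_i z w^-1 satisfy Carmichael's relations, as
    (z w^-1)^3 = z^-1 t and (z w^-1)^4 = w^-1 t. They generate a subgroup S of
    E / N that maps isomorphically to A6; with the center, S generates E / N,
    so [E, E] maps into S. *)
Lemma commutator_kernel A B P Q :
  p A = x_ 3 -> p B = g012 -> p P = x_ 0 * x_ 1 -> p Q = x_ 1 * x_ 0 ->
  forall e, commutator_subgroup setT setT e -> p e = 1 ->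
  exists i j, e = [~ A, B] ^+ i * [~ P, Q] ^+ j.
Proof.
move=> pA pB pP pQ.
have [X [g [z [w [pX pg [Cz Cw] X3 X2]]]]] := normalized_lifts cp.
rewrite (comm_lift cp (a := A) (b := B) (a' := X 3%N) (b' := g)) ?pA ?pB ?pX //.
rewrite (comm_lift cp (a := P) (b := Q) (a' := X 0%N * X 1%N) (b' := X 1%N * X 0%N));
  try by rewrite gmulfM !pX.
set d := [~ X 3%N, g] in X2 *; set t := [~ X 0%N * _, _].
have tE : t = z ^+ 4 * w ^- 3.
  by apply: tetrahedral_comm; rewrite ?X3 // X2 // mulg1.
have cd : commute (p (X 3%N)) (p g) by rewrite pX // pg; exact: x3_g012_commute.
have ct : commute (p (X 0%N * X 1%N)) (p (X 1%N * X 0%N)).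
  by rewrite !gmulfM !pX //; exact: four_group_commute.
have Cd : center d := comm_center cp cd.
have Ct : center t := comm_center cp ct.
have d3 : d ^+ 3 = 1 by apply: (comm_torsion cp cd); rewrite pg g012_cube.
have t2 : t ^+ 2 = 1 by apply: (comm_torsion cp ct); rewrite gmulfM !pX // x_mul2.
have pd : p d = 1 by rewrite gmulfR; apply/eqP/commgP.
have pt : p t = 1 by rewrite gmulfR; apply/eqP/commgP.
pose N : set E := [set e | exists i j, e = d ^+ i * t ^+ j].
have sN : is_subgroup N by exact: (monomials_subgroup d3 t2 Cd).
have NC : N `<=` @center E by move=> _ [i [j ->]];
  exact: centerM (centerX i Cd) (centerX j Ct).
have nN := central_normal sN NC.
have [p' p'E] : exists p' : UMagmaMorphism.type (quot_group N) A6, forall e,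
  p' (quot_pi N e) = p e.
  apply: quot_factor => _ [i [j ->]].
  by rewrite gmulfM !gmulfXn pd pt !expg1n mulg1.
pose c := z * w^-1.
have Cc : center c by apply: centerM Cz (centerV Cw).
have cX n : c ^+ n = z ^+ n * w ^- n.
  by rewrite expgM_central ?expVgn //; exact: centerV.
have pi1 := quot_pi_eq1 _ nN.
pose Y i := quot_pi N (X i * c).
have pc : p c = 1.
  apply: A6_center => a; have [e <-] := ext_lift cp a.
  by rewrite -!gmulfM Cc.
have pY i : (i < 4)%N -> p' (Y i) = x_ i.
  by move=> i4; rewrite p'E gmulfM pc mulg1 pX.
have Y3 i : (i < 4)%N -> Y i ^+ 3 = 1.
  move=> i4; rewrite -gmulfXn; apply/pi1; exists 0%N, 1%N.
  by rewrite expgM_central // X3 // cX expg0 mul1g expg1 tE mulgA -expgS.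
have Y2 i j : (i < j < 4)%N -> (Y i * Y j) ^+ 2 = 1.
  move=> ij; rewrite -!gmulfM -gmulfXn.
  have -> : X i * c * (X j * c) = X i * X j * c ^+ 2.
    by rewrite -(mulgA (X i)) (Cc (X j * c)) -(mulgA (X j)) (mulgA (X i)).
  rewrite expgM_central; last exact: centerX.
  rewrite (X2 _ _ ij) -expgnA (cX 4%N); set k := if _ then _ else _.
  apply/pi1; exists k, 1%N; rewrite tE expg1.
  rewrite Cw -mulgA; congr (_ * _); rewrite Cw -mulgA; congr (_ * _).
  by rewrite (expgS w 3) invgM mulgVK.
have inj := carmichael_faithful pY Y3 Y2.
pose S := sgen (first_gens Y 4).
have sS : is_subgroup S by exact: sgen_subgroup.
have SC q : exists s k, [/\ S s, center k & q = s * k].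
  have [s Ss ps] : exists2 s, S s & p' s = p' q.
    have : sgen (first_gens x_ 4) (p' q) by exact: x_generate.
    apply: (sgen_sub (image_subgroup p' sS)).
    move=> _ [i i4 ->]; exists (Y i); last exact: pY.
    by apply: sub_sgen; exists i.
  exists s, (s^-1 * q); rewrite mulVKg; split=> //.
  have := quot_pi_surj (s^-1 * q) => -[r rE]; rewrite -rE.
  have pr : p r = 1 by rewrite -p'E rE gmulfM gmulfV ps mulVg.
  move=> a; have [b <-] := quot_pi_surj a.
  by rewrite -!gmulfM (ker_center cp pr).
have DS := derived_generated sS SC.
move=> e De pe; apply/pi1/inj; last by rewrite p'E.
move: e De {pe}; apply: (sgen_sub (preim_subgroup (quot_pi N) sS)).
move=> _ [a _ [b _ <-]] /=; rewrite gmulfR; apply: DS.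
by apply: sub_sgen; exists (quot_pi N a) => //; exists (quot_pi N b).
Qed.

End CommutatorKernel.

(** * Two projective representations of A6 *)

(** If the A_i satisfy Carmichael's relations up to elements that commute with
    all A_k, then x_i |-> A_i is a projective representation of A6. The group E
    is its pullback, generated by the pairs (x_i, A_i). That the kernel of the
    projection to A6 is central is Carmichael's presentation, applied to the
    quotient of E by the central part N of this kernel. *)
Lemma projective_extension (K : groupType) (A : nat -> K) :
  (forall i k, (i < 4)%N -> (k < 4)%N -> commute (A i ^+ 3) (A k)) ->
  (forall i j k, (i < j < 4)%N -> (k < 4)%N -> commute ((A i * A j) ^+ 2) (A k)) ->
  exists (E : groupType) (p : UMagmaMorphism.type E A6)
    (q : UMagmaMorphism.type E K) (X : nat -> E),
  is_central_extension p /\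
  forall i, (i < 4)%N -> p (X i) = x_ i /\ q (X i) = A i.
Proof.
move=> A3c A2c.
pose XA i : A6 * K := (x_ i, A i).
have sS := sgen_subgroup (first_gens XA 4).
pose E : groupType := subgroup_type sS.
have valE (e : E) : sgen (first_gens XA 4) (val e) by have := valP e; rewrite inE.
have [p pE] : exists p : UMagmaMorphism.type E A6, forall e, p e = (val e).1.
  by apply: morphism_of => a b; rewrite valM.
have [q qE] : exists q : UMagmaMorphism.type E K, forall e, q e = (val e).2.
  by apply: morphism_of => a b; rewrite valM.
have XS i : (i < 4)%N -> XA i \in sgen (first_gens XA 4).
  by move=> i4; rewrite inE; apply: sub_sgen; exists i.
pose X i : E := insubd (1 : E) (XA i).
have XE i : (i < 4)%N -> val (X i) = XA i.
  by move=> i4; rewrite val_insubd XS.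
have pX i : (i < 4)%N -> p (X i) = x_ i by move=> i4; rewrite pE XE.
have qX i : (i < 4)%N -> q (X i) = A i by move=> i4; rewrite qE XE.
have valE2 (e : E) : val e = (p e, q e) by rewrite pE qE -surjective_pairing.
have centerE (e : E) : p e = 1 -> (forall k, (k < 4)%N -> commute (q e) (A k)) ->
  center e.
  move=> pe qe f; apply/val_inj; rewrite !valM.
  apply: (sgen_sub (centralizer_subgroup (val e))) (valE f).
  move=> _ [k k4 ->] /=; rewrite valE2 pe; congr (_, _); last exact: qe.
  by rewrite /= mul1g mulg1.
pose N := [set e : E | center e /\ p e = 1].
have sN : is_subgroup N.
  split=> [|a b [Ca pa] [Cb pb]|a [Ca pa]].
  - by split; [exact: center1|exact: gmulf1].
  - by split; [exact: centerM|rewrite gmulfM pa pb mulg1].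
  - by split; [exact: centerV|rewrite gmulfV pa invg1].
have nN : is_normal N by apply: central_normal sN _ => a [].
have [p' p'E] : exists p' : UMagmaMorphism.type (quot_group N) A6, forall e,
  p' (quot_pi N e) = p e.
  by apply: quot_factor => a [].
pose Y i := quot_pi N (X i).
have pi1 := quot_pi_eq1 _ nN.
have inj : forall g, sgen (first_gens Y 4) g -> p' g = 1 -> g = 1.
  apply: carmichael_faithful => [i i4|i i4|i j ij].
  - by rewrite p'E pX.
  - rewrite -gmulfXn; apply/pi1; have p1 : p (X i ^+ 3) = 1
      by rewrite gmulfXn pX // x_cube.
    split=> //; apply: centerE => // k k4; rewrite gmulfXn qX //; exact: A3c.
  - have /andP[i_j j4] := ij; have i4 := ltn_trans i_j j4.
    rewrite -gmulfM -gmulfXn; apply/pi1.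
    have p1 : p ((X i * X j) ^+ 2) = 1.
      by rewrite gmulfXn gmulfM !pX // x_mul2 // neq_ltn i_j.
    split=> //; apply: centerE => // k k4; rewrite gmulfXn gmulfM !qX //; exact: A2c.
have genY (e : E) : sgen (first_gens Y 4) (quot_pi N e).
  pose Z := [set h | exists2 f : E, val f = h & sgen (first_gens Y 4) (quot_pi N f)].
  have [f /val_inj -> //] : Z (val e).
  apply: (sgen_sub (H := Z)) (valE e).
    split=> [|_ _ [f <- Sf] [g <- Sg]|_ [f <- Sf]].
    - by exists 1; rewrite ?val1 // gmulf1; exact: sgen1.
    - by exists (f * g); rewrite ?valM // gmulfM; exact: sgenM.
    - exists f^-1; last by rewrite gmulfV; exact: sgenV.
      by apply: (mulgI (val f)); rewrite -valM !mulgV val1.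
  move=> _ [i i4 ->]; exists (X i); first exact: XE.
  by apply: sub_sgen; exists i.
exists E, p, q, X; split; last by move=> i i4; rewrite pX ?qX.
split=> [g|e /= pe].
  apply: (sgen_onto (f := p)) (x_generate g) => _ [i i4 ->].
  by exists (X i); exact: pX.
suff /pi1[] : quot_pi N e = 1 by [].
by apply: inj; rewrite ?p'E.
Qed.

Section FiniteFields.
Import GRing.Theory.
Local Open Scope ring_scope.

Lemma exists_non_root (F : finFieldType) (p : {poly F}) :
  p != 0 -> (size p <= #|F|)%N -> exists x, p.[x] != 0.
Proof.
move=> p0 sp; apply/existsP; apply: contraLR sp => /existsPn p_.
rewrite -ltnNge cardE; apply: max_poly_roots p0 _ (enum_uniq _).
by apply/allP => x _; rewrite /root; have := p_ x; rewrite negbK.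
Qed.

(** An element of F_4 outside F_2 is a root of X^2 + X + 1. *)
Lemma field4 : exists (F : finFieldType) (w : F), 2%:R = 0 :> F /\ w * w = w + 1.
Proof.
have [F /andP[_ /eqP c2] F4] := @pPrimePowerField 2 2 isT isT.
have [||x] := @exists_non_root F ('X^2 - 'X).
- by rewrite -size_poly_gt0 size_polyDl ?size_polyXn // size_polyN size_polyX.
- by rewrite size_polyDl ?size_polyXn ?F4 // size_polyN size_polyX.
rewrite !hornerE => x2; exists F, x; split=> //.
have x4 : x ^+ 4 = x by rewrite -[LHS]/(x ^+ (2 ^ 2)) -F4 expf_card.
have : (x ^+ 2 - x) * (x ^+ 2 + x + 1) = 0.
  have -> : (x ^+ 2 - x) * (x ^+ 2 + x + 1) = x ^+ 4 - x by ring.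
  by rewrite x4 subrr.
move=> /eqP; rewrite mulf_eq0 (negPf x2) /= => /eqP E.
have -> : x * x = (x ^+ 2 + x + 1) - 2%:R * (x + 1) + (x + 1) by ring.
by rewrite E c2 mul0r subrr add0r.
Qed.

(** X^9 - X = (X^5 - X)(X^4 + 1), so an element that is not a root of the first
    factor has fourth power -1. *)
Lemma field9 : exists (F : finFieldType) (i : F), 3%:R = 0 :> F /\ i * i = -1.
Proof.
have [F /andP[_ /eqP c3] F9] := @pPrimePowerField 3 2 isT isT.
have [||x] := @exists_non_root F ('X^5 - 'X).
- by rewrite -size_poly_gt0 size_polyDl ?size_polyXn // size_polyN size_polyX.
- by rewrite size_polyDl ?size_polyXn ?F9 // size_polyN size_polyX.
rewrite !hornerE => x5; exists F, (x ^+ 2); split=> //.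
have x9 : x ^+ 9 = x by rewrite -[LHS]/(x ^+ (3 ^ 2)) -F9 expf_card.
have : (x ^+ 5 - x) * (x ^+ 4 + 1) = 0.
  have -> : (x ^+ 5 - x) * (x ^+ 4 + 1) = x ^+ 9 - x by ring.
  by rewrite x9 subrr.
move=> /eqP; rewrite mulf_eq0 (negPf x5) /= addr_eq0 => /eqP <-.
by ring.
Qed.

End FiniteFields.

Section LinearGenerators.
Import GRing.Theory.
Local Open Scope ring_scope.
Variables (F : comNzRingType).

Lemma pair_eq (R : nmodType) (a b c d : R) : a = c -> b = d -> (a, b) = (c, d).
Proof. by move=> -> ->. Qed.

Lemma eq_subr0 (a b : F) : a - b = 0 -> a = b.
Proof. by move=> /eqP; rewrite subr_eq0 => /eqP. Qed.

Section SL29.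
Variable i : F.
Hypotheses (c3 : 3%:R = 0 :> F) (i2 : i * i = -1).

(** The transvections v |-> v + i <v, u> u of F^2 for u = (1, 0), (0, 1), (1, 1)
    and (1, -1), where <v, u> = v_1 u_2 - v_2 u_1. They have order 3, and the
    product of two of them has square -1 because <u, u'>^2 = 1 for any two of
    these vectors: in characteristic 3, also <(1, 1), (1, -1)> = -2 = 1. *)
Definition gen29 (k : nat) (v : F * F) : F * F :=
  let: (a, b) := v in
  match k with
  | 0%N => (a - i * b, b)
  | 1%N => (a, b + i * a)
  | 2%N => (a + i * (a - b), b + i * (a - b))
  | _ => (a - i * (a + b), b + i * (a + b))
  end.

(* A rewriting rule given to ring applies to a constant only if the integer
   coefficients agree, sign included. *)
Let n3 : - 3%:R = 0 :> F. Proof. by rewrite c3 oppr0. Qed.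
Let c6 : 6%:R = 0 :> F. Proof. by rewrite (natrM _ 3 2) c3 mul0r. Qed.
Let n6 : - 6%:R = 0 :> F. Proof. by rewrite c6 oppr0. Qed.

Ltac char3 := apply: pair_eq; apply: eq_subr0; ring: i2 c3 n3 c6 n6.

Lemma gen29_cube k v : gen29 k (gen29 k (gen29 k v)) = v.
Proof. by case: v => a b; case: k => [|[|[|k]]] /=; char3. Qed.

Lemma gen29_scale k a b :
  gen29 k (- a, - b) = (- (gen29 k (a, b)).1, - (gen29 k (a, b)).2).
Proof. by case: k => [|[|[|k]]] /=; apply: pair_eq; ring. Qed.

Lemma gen29_prod j k v : (j < k < 4)%N ->
  gen29 k (gen29 j (gen29 k (gen29 j v))) = (- v.1, - v.2).
Proof.
case: v => a b /andP[+ +].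
case: k => [|[|[|[|k]]]] //; case: j => [|[|[|j]]] // _ _.
1-5: by rewrite /=; char3.
have P x y : gen29 3 (gen29 2 (x, y)) = ((1 + i) * y, (1 - i) * x).
  by rewrite /=; char3.
by rewrite !P /=; char3.
Qed.

Lemma gen29_noncomm :
  gen29 0 (gen29 1 (gen29 1 (gen29 0 (1, 0)))) <> gen29 1 (gen29 0 (gen29 0 (gen29 1
    (1, 0)))).
Proof.
move=> /= [_ E]; have /eqP := oner_neq0 F; apply.
have i0 : i = 0.
  apply: eq_subr0; have {E} := congr1 (fun a => a - 2%:R * i) E.
  rewrite [LHS](_ : _ = 0); last by ring.
  by rewrite [RHS](_ : _ = - (i - 0)); [move=> /esym/eqP;
    rewrite oppr_eq0 => /eqP|apply: eq_subr0; ring: i2 c3 n3 c6 n6].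
by rewrite -[1]opprK -i2 i0 mul0r oppr0.
Qed.

End SL29.

Section SL34.
Variable w : F.
Hypotheses (c2 : 2%:R = 0 :> F) (w2 : w * w = w + 1).

(** The points e_3, (1, 1, 1), (1, w, w^2), (1, w^2, w), e_1, e_2 of the
    projective plane over F_4, numbered 0, ..., 5, form a hyperoval: no three
    of them are collinear. The k-th map permutes the points k, 4, 5 cyclically
    and fixes the three others, so it represents x_k. *)
Definition gen34 (k : nat) (v : F * F * F) : F * F * F :=
  let: (a, b, c) := v in
  match k with
  | 0%N => (c, a, b)
  | 1%N => (b, a + b, b + c)
  | 2%N => ((w + 1) * b, w * a + b, w * b + c)
  | _ => (w * b, (w + 1) * a + b, (w + 1) * b + c)
  end.

Definition scale3 (l : F) (v : F * F * F) : F * F * F :=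
  let: (a, b, c) := v in (l * a, l * b, l * c).

Let n2 : - 2%:R = 0 :> F. Proof. by rewrite c2 oppr0. Qed.
Let c4 : 4%:R = 0 :> F. Proof. by rewrite (natrM _ 2 2) c2 mul0r. Qed.
Let n4 : - 4%:R = 0 :> F. Proof. by rewrite c4 oppr0. Qed.
Let c6 : 6%:R = 0 :> F. Proof. by rewrite (natrM _ 2 3) c2 mul0r. Qed.
Let c8 : 8%:R = 0 :> F. Proof. by rewrite (natrM _ 2 4) c2 mul0r. Qed.
Let n8 : - 8%:R = 0 :> F. Proof. by rewrite c8 oppr0. Qed.
Let n6 : - 6%:R = 0 :> F. Proof. by rewrite c6 oppr0. Qed.

Lemma triple_eq (a b c a' b' c' : F) : a = a' -> b = b' -> c = c' ->
  (a, b, c) = (a', b', c').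
Proof. by move=> -> -> ->. Qed.

Ltac char2 := apply: triple_eq; apply: eq_subr0; ring: w2 c2 n2 c4 n4 c6 n6 c8 n8.

Lemma gen34_cube k v : gen34 k (gen34 k (gen34 k v)) = v.
Proof. by case: v => [[a b] c]; case: k => [|[|[|k]]] /=; char2. Qed.

Lemma gen34_scale k l v : gen34 k (scale3 l v) = scale3 l (gen34 k v).
Proof. by case: v => [[a b] c]; case: k => [|[|[|k]]] /=; apply: triple_eq; ring. Qed.

Lemma gen34_prod j k : (j < k < 4)%N ->
  exists l, forall v, gen34 k (gen34 j (gen34 k (gen34 j v))) = scale3 l v.
Proof.
move=> /andP[].
case: k => [|[|[|[|k]]]] //; case: j => [|[|[|j]]] // _ _.
- by exists 1 => -[[a b] c] /=; char2.
- by exists w => -[[a b] c] /=; char2.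
- by exists 1 => -[[a b] c] /=; char2.
- by exists (w + 1) => -[[a b] c] /=; char2.
- have P x y z : gen34 3 (gen34 1 (x, y, z)) = (w * x + w * y, x + w * y,
    (w + 1) * x + w * y + z).
    by rewrite /=; char2.
  by exists 1 => -[[a b] c]; rewrite !P /=; char2.
- have P x y z : gen34 3 (gen34 2 (x, y, z)) = ((w + 1) * x + w * y,
    w * x + (w + 1) * y, x + y + z).
    by rewrite /=; char2.
  by exists 1 => -[[a b] c]; rewrite !P /=; char2.
Qed.

(** The map g represents g012 by [g012_word]. Both vectors are evaluated one
    generator at a time to keep the polynomials small. *)
Lemma gen34_noncomm (g := fun v => gen34 2 (gen34 1 (gen34 1 (gen34 0 (gen34 2 (gen34
  2 v)))))) :
  g (gen34 3 (1, 0, 0)) <> gen34 3 (g (1, 0, 0)).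
Proof.
have -> : g (gen34 3 (1, 0, 0)) = (0, w + 1, 0).
  rewrite /g.
  have -> : gen34 3 (1, 0, 0) = (0, w + 1, 0) by rewrite /=; char2.
  have -> : gen34 2 (0, w + 1, 0) = (w, w + 1, 1) by rewrite /=; char2.
  have -> : gen34 2 (w, w + 1, 1) = (w, 0, 0) by rewrite /=; char2.
  have -> : gen34 0 (w, 0, 0) = (0, w, 0) by rewrite /=; char2.
  have -> : gen34 1 (0, w, 0) = (w, w, w) by rewrite /=; char2.
  have -> : gen34 1 (w, w, w) = (w, 0, 0) by rewrite /=; char2.
  have -> : gen34 2 (w, 0, 0) = (0, w + 1, 0) by rewrite /=; char2.
  by [].
have -> : gen34 3 (g (1, 0, 0)) = (0, 1, 0).
  rewrite /g.
  have -> : gen34 2 (1, 0, 0) = (0, w, 0) by rewrite /=; char2.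
  have -> : gen34 2 (0, w, 0) = (1, w, w + 1) by rewrite /=; char2.
  have -> : gen34 0 (1, w, w + 1) = (w + 1, 1, w) by rewrite /=; char2.
  have -> : gen34 1 (w + 1, 1, w) = (1, w, w + 1) by rewrite /=; char2.
  have -> : gen34 1 (1, w, w + 1) = (w, w + 1, 1) by rewrite /=; char2.
  have -> : gen34 2 (w, w + 1, 1) = (w, 0, 0) by rewrite /=; char2.
  have -> : gen34 3 (w, 0, 0) = (0, 1, 0) by rewrite /=; char2.
  by [].
move=> [E]; have /eqP := oner_neq0 F; apply.
have w0 : w = 0 by apply: (addIr 1); rewrite E add0r.
by move: w2; rewrite w0 mul0r add0r => <-.
Qed.

End SL34.
End LinearGenerators.

Section TwoLifts.

Lemma perm_of_order3 (V : finType) (f : V -> V) :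
  (forall v, f (f (f v)) = v) -> exists s : {perm V}, forall v, s v = f v.
Proof.
move=> f3; have fI : injective f by apply: (can_inj (g := fun v => f (f v))).
by exists (perm fI) => v; rewrite permE.
Qed.

(** The extension 2.A6 = SL_2(9): lifts of two generators of a Klein four-group
    do not commute. *)
Lemma double_cover : exists (E : groupType) (p : UMagmaMorphism.type E A6) P Q,
  [/\ is_central_extension p, p P = x_ 0 * x_ 1, p Q = x_ 1 * x_ 0 & [~ P, Q] <> 1].
Proof.
have [F [i [c3 i2]]] := field9.
have [A AE] : exists A : nat -> {perm F * F}, forall k v, A k v = gen29 i k v.
  exists (fun k => sval (cid (perm_of_order3 (gen29_cube c3 i2 k)))) => k.
  exact: svalP (cid (perm_of_order3 (gen29_cube c3 i2 k))).
have [||E [p [q [X [cp Xk]]]]] := @projective_extension _ A.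
- move=> j k _ _; rewrite (_ : A j ^+ 3 = 1); first exact: commute_sym (commute1 _).
  by apply/permP => v; rewrite !expgS expg0 mulg1 !permM perm1 !AE gen29_cube.
- move=> j l k jl _; apply/permP => v.
  by rewrite expg2 !permM !AE !gen29_prod // gen29_scale -surjective_pairing.
have [pX0 qX0] := Xk 0%N isT; have [pX1 qX1] := Xk 1%N isT.
exists E, p, (X 0%N * X 1%N), (X 1%N * X 0%N); split=> //;
  try by rewrite gmulfM pX0 pX1.
move=> /(congr1 q)/eqP; rewrite gmulfR gmulf1 !gmulfM qX0 qX1 => /commgP.
move=> /permP/(_ (1%R, 0%R)); rewrite !permM !AE.
exact: gen29_noncomm.
Qed.

(** The squares are inverses; they avoid inverting the linear maps. *)
Lemma g012_word : g012 = (x_ 2) ^+ 2 * x_ 0 * (x_ 1) ^+ 2 * x_ 2.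
Proof.
by apply: pt_eq; do 6?[case=> [|]]; move=> //= _;
  rewrite pt_g012 // !expg2 !ptM !pt_x.
Qed.

(** The extension 3.A6 in SL_3(4): lifts of two disjoint 3-cycles do not
    commute. *)
Lemma triple_cover : exists (E : groupType) (p : UMagmaMorphism.type E A6) A B,
  [/\ is_central_extension p, p A = x_ 3, p B = g012 & [~ A, B] <> 1].
Proof.
have [F [w [c2 w2]]] := field4.
have [A AE] : exists A : nat -> {perm F * F * F}, forall k v, A k v = gen34 w k v.
  exists (fun k => sval (cid (perm_of_order3 (gen34_cube c2 w2 k)))) => k.
  exact: svalP (cid (perm_of_order3 (gen34_cube c2 w2 k))).
have [||E [p [q [X [cp Xk]]]]] := @projective_extension _ A.
- move=> j k _ _; rewrite (_ : A j ^+ 3 = 1); first exact: commute_sym (commute1 _).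
  by apply/permP => v; rewrite !expgS expg0 mulg1 !permM perm1 !AE gen34_cube.
- move=> j l k jl _; apply/permP => v.
  have [s sE] := gen34_prod c2 w2 jl.
  by rewrite expg2 !permM !AE !sE gen34_scale.
have [pX0 qX0] := Xk 0%N isT; have [pX1 qX1] := Xk 1%N isT.
have [pX2 qX2] := Xk 2%N isT; have [pX3 qX3] := Xk 3%N isT.
exists E, p, (X 3%N), ((X 2%N) ^+ 2 * X 0%N * (X 1%N) ^+ 2 * X 2%N); split=> //.
  by rewrite g012_word !expg2 !gmulfM pX0 pX1 pX2.
move=> /(congr1 q)/eqP; rewrite gmulfR gmulf1 !expg2 !gmulfM qX0 qX1 qX2 qX3 => /commgP.
move=> /permP/(_ (1%R, 0%R, 0%R)); rewrite !permM !AE.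
exact: gen34_noncomm.
Qed.

End TwoLifts.

(** * The multiplier and the maps mu_x in versal extensions *)

(** An extension that maps to every other one, without a uniqueness condition:
    both A6^* and F_X / [F_X, R_X] qualify, although the latter is not
    perfect. *)
Definition versal (E : groupType) (p : UMagmaMorphism.type E A6) : Prop :=
  is_central_extension p /\
  forall (E' : groupType) (q : UMagmaMorphism.type E' A6),
    is_central_extension q ->
    exists f : UMagmaMorphism.type E E', forall e, q (f e) = p e.

Notation derived E := (commutator_subgroup (@setT E) (@setT E)).

Lemma derived_comm (E : groupType) (a b : E) : derived E [~ a, b].
Proof. by apply: sub_sgen; exists a => //; exists b. Qed.

(** The image of mu_x, computed in an arbitrary central extension. *)
Definition kappa (E : groupType) (p : UMagmaMorphism.type E A6) (x : A6) : set E :=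
  [set z | exists h y, [/\ p y = x, commute (p h) x & z = [~ h, y]]].

Lemma kappa_sub (E : groupType) (p : UMagmaMorphism.type E A6) x z :
  kappa p x z -> derived E z /\ p z = 1.
Proof.
move=> [h [y [yx hx ->]]]; split; first exact: derived_comm.
by rewrite gmulfR yx; apply/eqP/commgP.
Qed.

Lemma kappaJ (E : groupType) (p : UMagmaMorphism.type E A6) x g :
  is_central_extension p -> kappa p (x ^ g) = kappa p x.
Proof.
move=> cp; suff H a b : kappa p a `<=` kappa p (a ^ b).
  by apply/seteqP; split; [rewrite -{2}(conjgK g x)|]; exact: H.
move=> _ [h [y [<- hy ->]]]; have [e <-] := ext_lift cp b.
exists (h ^ e), (y ^ e); split; first exact: gmulfJ.
  by rewrite /commute gmulfJ -!conjMg hy.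
by rewrite (comm_conj cp).
Qed.

Lemma kappa_torsion (E : groupType) (p : UMagmaMorphism.type E A6) x z n :
  is_central_extension p -> kappa p x z -> x ^+ n = 1 -> z ^+ n = 1.
Proof. by move=> cp [h [y [<- hy ->]]] xn; exact: (comm_torsion cp hy xn). Qed.

Section Versal.
Variables (E : groupType) (p : UMagmaMorphism.type E A6).
Hypothesis vp : versal p.

(** The multiplier, as the intersection of ker p with [E, E], is cyclic of
    order 6 with generator c. *)
Definition kernel_generator (c : E) : Prop :=
  [/\ derived E c, p c = 1, forall k, c ^+ k = 1 <-> (6 %| k)%N &
      forall e, derived E e -> p e = 1 -> exists k, e = c ^+ k].

(** When m divides 6, the relative multiplier is then cyclic of order m. *)
Definition kappa_index c x m := forall z, kappa p x z <-> exists k, z = c ^+ (m * k).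

(** Mapping E to 3.A6 and 2.A6 shows that d and t are not trivial, so c = d t
    has order 6, with d = c^4 and t = c^3. An element of the multiplier killed
    by n is a power of c^(6 / n), which bounds the image of mu_x for x of order
    n; commutators with powers of the lifts A and P attain the bound. *)
Lemma versal_kernel : exists c, [/\ kernel_generator c, kappa_index c g012 2,
  kappa_index c (g012 * x_ 3) 2 & kappa_index c (x_ 1 * x_ 0) 3].
Proof.
have [cp up] := vp.
have [A pA] := ext_lift cp (x_ 3); have [B pB] := ext_lift cp g012.
have [P pP] := ext_lift cp (x_ 0 * x_ 1); have [Q pQ] := ext_lift cp (x_ 1 * x_ 0).
have cAB : commute (p A) (p B) by rewrite pA pB; exact: x3_g012_commute.
have cPQ : commute (p P) (p Q) by rewrite pP pQ; exact: four_group_commute.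
pose d := [~ A, B]; pose t := [~ P, Q].
have Cd : center d := comm_center cp cAB.
have Ct : center t := comm_center cp cPQ.
have d3 : d ^+ 3 = 1 by apply: (comm_torsion cp cAB); rewrite pB g012_cube.
have t2 : t ^+ 2 = 1 by apply: (comm_torsion cp cPQ); rewrite pQ x_mul2.
have d1 : d <> 1.
  move=> d1; have [E' [q [A' [B' [cq qA qB]]]]] := triple_cover.
  have [f qf] := up _ _ cq; apply; have <- : f d = 1 by rewrite d1 gmulf1.
  by rewrite gmulfR; apply: (comm_lift cq); rewrite qf ?qA ?qB.
have t1 : t <> 1.
  move=> t1; have [E' [q [A' [B' [cq qA qB]]]]] := double_cover.
  have [f qf] := up _ _ cq; apply; have <- : f t = 1 by rewrite t1 gmulf1.
  by rewrite gmulfR; apply: (comm_lift cq); rewrite qf ?qA ?qB.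
pose c := d * t.
have cX k : c ^+ k = d ^+ k * t ^+ k by rewrite expgM_central.
have tc : t = c ^+ 3 by rewrite cX d3 mul1g expgS t2 mulg1.
have dc : d = c ^+ 4 by rewrite cX (expgnDr t 2 2) t2 mulg1 expgS d3 !mulg1.
have c6 : c ^+ 6 = 1 by rewrite (expgnA c 3 2) -tc.
have ord k : c ^+ k = 1 <-> (6 %| k)%N.
  split=> [ck|/dvdnP[l ->]]; last by rewrite mulnC expgnA c6 expg1n.
  rewrite (@Gauss_dvd 2 3) //; apply/andP; split.
    have : t ^+ k = 1 by rewrite tc -expgnA mulnC expgnA ck expg1n.
    rewrite {1}(divn_eq k 2) expgnDr mulnC expgnA t2 expg1n mul1g /dvdn.
    by have := ltn_pmod k (isT : 0 < 2)%N; case: (k %% 2)%N => [|[|]].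
  have : d ^+ k = 1 by rewrite dc -expgnA mulnC expgnA ck expg1n.
  rewrite {1}(divn_eq k 3) expgnDr mulnC expgnA d3 expg1n mul1g /dvdn.
  have := ltn_pmod k (isT : 0 < 3)%N; case: (k %% 3)%N => [|[|[|]]] // _ d2.
  by case: d1; rewrite -d3 expgS d2 mulg1.
have gen e : derived E e -> p e = 1 -> exists k, e = c ^+ k.
  move=> De pe; have [i [j ->]] := commutator_kernel cp pA pB pP pQ De pe.
  by exists (4 * i + 3 * j)%N; rewrite -/d -/t dc tc -!expgnA -expgnDr.
have kap x z n m : kappa p x z -> x ^+ n = 1 -> (6 = n * m)%N ->
    exists k, z = c ^+ (m * k).
  move=> kz xn nm6; have [Dz pz] := kappa_sub kz; have [k zE] := gen _ Dz pz.
  have := kappa_torsion cp kz xn; rewrite zE -expgnA => /ord; rewrite nm6 mulnC.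
  have n0 : (0 < n)%N by case: (n) nm6.
  by rewrite dvdn_pmul2r // => /dvdnP[l ->]; exists l; rewrite mulnC.
exists c; split.
- split=> //.
    case: (smallest_is_subgroup [set [~ a, b] | a in @setT E & b in @setT E]) => _ DM _.
    by apply: DM; exact: derived_comm.
  by rewrite gmulfM !gmulfR; move/commgP/eqP: cAB ->; move/commgP/eqP: cPQ ->;
    rewrite mulg1.
- move=> z; split=> [kz|[k ->]]; first exact: (kap _ _ 3%N 2%N kz g012_cube).
  exists (A ^+ (2 * k)), B; rewrite gmulfXn -pB; split=> //.
    exact/commute_sym/commuteX/commute_sym.
  by rewrite commXg_central // -/d cX (expgnA t) t2 expg1n mulg1.
- have x3 : (g012 * x_ 3) ^+ 3 = 1.
    by rewrite expgMn ?g012_cube ?x_cube ?mulg1 //; exact/commute_sym/x3_g012_commute.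
  move=> z; split=> [kz|[k ->]]; first exact: (kap _ _ 3%N 2%N kz x3).
  exists (A ^+ (2 * k)), (B * A); rewrite gmulfXn gmulfM pB pA; split=> //.
    apply: commute_sym; apply: commuteX; apply: commute_sym.
    by rewrite pA; apply: commuteM; [exact: x3_g012_commute|].
  have AkB : [~ A ^+ (2 * k), B] = d ^+ (2 * k) by rewrite commXg_central.
  rewrite commgM_central; last by rewrite AkB; exact: centerX.
  have /commgP/eqP -> : commute (A ^+ (2 * k)) A by exact/commute_sym/commuteX.
  by rewrite mulg1 AkB cX (expgnA t) t2 expg1n mulg1.
- move=> z; split=> [kz|[k ->]].
    by apply: (kap _ _ 2%N 3%N kz) => //; rewrite x_mul2.
  exists (P ^+ (3 * k)), Q; rewrite gmulfXn -pQ; split=> //.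
    exact/commute_sym/commuteX/commute_sym.
  by rewrite commXg_central // -/t cX (expgnA d) d3 expg1n mul1g.
Qed.

Lemma kappa_conj c x y m : conj_class x y -> kappa_index c x m -> kappa_index c y m.
Proof.
have [cp _] := vp; move=> [h _ <-] kx z.
rewrite -(kx z) (_ : h * x * h^-1 = x ^ h^-1) ?kappaJ //.
by rewrite conjgE invgK mulgA.
Qed.

(** The multiplier has no element of order 5; and if the centralizer of x is
    generated by x, then commuting lifts can be chosen. *)
Lemma kappa_trivial c x : kernel_generator c ->
  (x ^+ 5 = 1 \/ forall g, commute g x -> exists k, g = x ^+ k) ->
  kappa_index c x 6.
Proof.
have [cp _] := vp.
move=> [Dc pc ord gen] xH z; split=> [kz|[k ->]]; last first.
  have [y py] := ext_lift cp x; exists 1, y; rewrite comm1g gmulf1; split=> //.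
    exact/commute_sym/commute1.
  by apply/ord; rewrite dvdn_mulr.
exists 0%N; rewrite muln0; case: xH => [x5|xc].
  have [Dz pz] := kappa_sub kz; have [k zE] := gen _ Dz pz.
  have := kappa_torsion cp kz x5; rewrite zE -expgnA => /ord.
  by rewrite Gauss_dvdl // => /ord ->.
have [h [y [yx hx ->]]] := kz; have [k hk] := xc _ hx.
rewrite (comm_lift cp (a' := y ^+ k) (b' := y)) //; last by rewrite gmulfXn yx.
by apply/eqP/commgP/commute_sym/commuteX.
Qed.

End Versal.

(** * The conjugacy classes of A6 *)

Section Classes.

(** A product of transpositions: both its table of values and its parity can be
    read off from the list. *)
Definition swap_word := seq (nat * nat).

Definition word_fun (w : swap_word) (k : nat) : nat :=
  foldl (fun k ab => if k == ab.1 then ab.2 else if k == ab.2 then ab.1 else k) k w.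

Definition word_perm (w : swap_word) : {perm 'I_6} :=
  foldr (fun ab s => tperm (o ab.1) (o ab.2) * s) 1 w.

Definition word_ok (w : swap_word) :=
  all (fun ab => [&& ab.1 < 6, ab.2 < 6 & ab.1 != ab.2]%N) w.

Lemma word_permE w k : word_ok w -> (k < 6)%N ->
  word_perm w (o k) = o (word_fun w k) /\ (word_fun w k < 6)%N.
Proof.
elim: w k => [|[a b] w IHw] k /=; first by rewrite perm1.
case/andP => /and3P[a6 b6 ab] ok k6; rewrite permM.
have [->|ka] := eqVneq k a; first by rewrite tpermL; exact: IHw.
have [->|kb] := eqVneq k b; first by rewrite tpermR; exact: IHw.
by rewrite tpermD ?eq_o // 1?eq_sym //; exact: IHw.
Qed.

Lemma odd_word_perm w : word_ok w -> odd_perm (word_perm w) = odd (size w).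
Proof.
elim: w => [|[a b] w IHw] /=; first by rewrite odd_perm1.
by case/andP => /and3P[a6 b6 ab] /IHw IH; rewrite odd_permM odd_tperm eq_o // ab IH.
Qed.

(** Standard representatives: consecutive cycles of decreasing length. The word
    w5' is the other class of 5-cycles. *)
Definition w3 : swap_word := [:: (0, 1); (0, 2)]%N.
Definition w33 : swap_word := [:: (0, 1); (0, 2); (3, 4); (3, 5)]%N.
Definition w22 : swap_word := [:: (0, 1); (2, 3)]%N.
Definition w42 : swap_word := [:: (0, 1); (0, 2); (0, 3); (4, 5)]%N.
Definition w5 : swap_word := [:: (0, 1); (0, 2); (0, 3); (0, 4)]%N.
Definition w5' : swap_word := [:: (0, 1); (0, 2); (0, 3); (0, 5)]%N.

Definition even_words := [:: w3; w33; w22; w42; w5].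
Definition odd_words : seq swap_word :=
  [:: [:: (0, 1)]; [:: (0, 1); (0, 2); (3, 4)]; [:: (0, 1); (2, 3); (4, 5)];
      [:: (0, 1); (0, 2); (0, 3)]; [:: (0, 1); (0, 2); (0, 3); (0, 4); (0, 5)]]%N.

(** The cycle through k is a period of k, l k, l (l k), ...; it is kept only when
    it is listed from its smallest element, so that it occurs once. *)
Definition cycles (l : seq nat) : seq (seq nat) :=
  sort (fun a b => size b <= size a)%N
    [seq c <- [seq undup (traject (nth 0%N l) k 6) | k <- iota 0 6]
       | head 0%N c == foldr minn 6%N c].
(** Renaming the points in the order in which the cycles list them conjugates
    the permutation to a standard representative. *)
Definition relabel (l : seq nat) : seq nat :=
  [seq index k (flatten (cycles l)) | k <- iota 0 6].

Definition conj_check (l : seq nat) : bool :=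
  let m := relabel l in
  perm_eq m (iota 0 6) &&
  has (fun w => all (fun k => nth 0%N m (nth 0%N l k) == word_fun w (nth 0%N m k))
    (iota 0 6))
    ([::] :: even_words ++ odd_words).

Lemma conj_checked : all conj_check (permutations (iota 0 6)).
Proof. by vm_compute. Qed.

Definition table (s : {perm 'I_6}) : seq nat := [seq val (s (o k)) | k <- iota 0 6].

Lemma nth_table (s : {perm 'I_6}) k : (k < 6)%N -> s (o k) = o (nth 0%N (table s) k).
Proof.
move=> k6; rewrite (nth_map 0%N) ?size_iota // nth_iota // add0n.
by apply/val_inj; rewrite /= inordK.
Qed.

Lemma table_perm (s : {perm 'I_6}) : perm_eq (table s) (iota 0 6).
Proof.
have us : uniq (table s).
  rewrite map_inj_in_uniq ?iota_uniq // => j k; rewrite !mem_iota => j6 k6.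
  by move=> /val_inj/perm_inj/eqP; rewrite eq_o // => /eqP.
apply: uniq_perm => //.
have sub : {subset table s <= iota 0 6}.
  by move=> _ /mapP[k _ ->]; rewrite mem_iota /= ltn_ord.
by apply: (uniq_min_size us sub _).2; rewrite size_map.
Qed.

Lemma perm_of_table (m : seq nat) : perm_eq m (iota 0 6) ->
  exists s : {perm 'I_6}, forall k, (k < 6)%N ->
    s (o k) = o (nth 0%N m k) /\ (nth 0%N m k < 6)%N.
Proof.
move=> pm; have m6 k : (k < 6)%N -> (nth 0%N m k < 6)%N.
  move=> k6; have : nth 0%N m k \in m by rewrite mem_nth // (perm_size pm).
  by rewrite (perm_mem pm) mem_iota.
have fI : injective (fun i : 'I_6 => o (nth 0%N m i)).
  move=> i j /eqP; rewrite eq_o ?m6 // nth_uniq ?(perm_size pm) //.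
    by move=> /eqP /val_inj.
  by rewrite (perm_uniq pm) iota_uniq.
by exists (perm fI) => k k6; rewrite permE inordK // m6.
Qed.

Lemma words_ok : all word_ok (even_words ++ odd_words).
Proof. by []. Qed.

Lemma S6_classes (s : {perm 'I_6}) :
  exists h w, w \in [::] :: even_words ++ odd_words /\ s ^ h = word_perm w.
Proof.
have := allP conj_checked (table s); rewrite mem_permutations table_perm => /(_ isT).
move=> /andP[/perm_of_table[h hE] /hasP[w wW /allP H]]; exists h, w; split=> //.
have wok : word_ok w.
  by move: wW; rewrite inE => /orP[/eqP -> //|]; exact: (allP words_ok).
suff E : h * word_perm w = s * h by rewrite conjgE -E mulKg.
apply/permP => i; have [k k6 ->] := o_surj i; rewrite !permM (nth_table s) //.
have pt6 : (nth 0%N (table s) k < 6)%N.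
  by rewrite (nth_map 0%N) ?size_iota // ltn_ord.
have [_ m6] := hE _ k6.
rewrite (hE _ pt6).1 (hE _ k6).1 (word_permE wok m6).1; congr o.
by apply/esym/eqP/H; rewrite mem_iota.
Qed.

End Classes.

Lemma word_perm_cat w w' : word_perm (w ++ w') = word_perm w * word_perm w'.
Proof. by elim: w => [|ab w IHw] /=; rewrite ?mul1g // IHw mulgA. Qed.

Lemma word_perm_eq w w' : word_ok w -> word_ok w' ->
  all (fun k => word_fun w k == word_fun w' k) (iota 0 6) ->
  word_perm w = word_perm w'.
Proof.
move=> ok ok' /allP ww; apply/permP => i; have [k k6 ->] := o_surj i.
rewrite (word_permE ok k6).1 (word_permE ok' k6).1; congr o.
by apply/eqP/ww; rewrite mem_iota.
Qed.

Definition rep (w : swap_word) : A6 := a6 (word_perm w).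

Lemma sgval_rep w : word_ok w -> ~~ odd (size w) -> sgval (rep w) = word_perm w.
Proof. by move=> ok ew; rewrite sgval_a6 // Alt_even odd_word_perm. Qed.

Lemma conj_classJ (g h : A6) : conj_class (g ^ h) = conj_class g.
Proof.
suff H a b : conj_class a `<=` @conj_class A6 (a ^ b).
  by apply/seteqP; split; [rewrite -{2}(conjgK h g)|]; exact: H.
move=> _ [c _ <-]; exists (c * b) => //.
by rewrite conjgE invgM !mulgA !mulgK.
Qed.

(** An odd permutation that centralizes the standard representative, except for
    w5, which it conjugates to w5'. It repairs a conjugating permutation that is
    odd: this is why only the class of 5-cycles of S6 splits in A6. *)
Definition odd_partner (w : swap_word) : swap_word :=
  if w == w33 then [:: (0, 3); (1, 4); (2, 5)]%N else [:: (4, 5)]%N.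

Ltac each_word H :=
  move: H; rewrite /even_words /odd_words !inE;
  do ?[case/orP=> [/eqP-> //|]]; move=> /eqP-> //.

(** Conjugate by some h in S6 to a standard representative, which is even as
    well; if h is odd, compose it with the odd partner. *)
Lemma nontrivial_class_rep (X : set A6) : is_nontrivial_class X ->
  exists2 w, w \in rcons even_words w5' & X = conj_class (rep w).
Proof.
move=> [g /eqP g1 ->]; have [h [w [wW gh]]] := S6_classes (sgval g).
have gE : ~~ odd_perm (sgval g) by rewrite -Alt_even; exact: subgP.
have wE : ~~ odd_perm (word_perm w) by rewrite -gh odd_permJ.
have {wW} wE' : w \in even_words.
  move: wW; rewrite inE => /orP[/eqP w0|].
    case: g1; apply/val_inj/eqP; rewrite -(conjg_eq1 _ h); apply/eqP.
    by move: gh; rewrite w0.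
  rewrite mem_cat => /orP[//|wO]; move: wE; rewrite odd_word_perm; last first.
    by apply: (allP words_ok); rewrite mem_cat wO orbT.
  by each_word wO.
have conjA6 k w' : word_ok w' -> ~~ odd (size w') -> ~~ odd_perm k ->
  sgval g ^ k = word_perm w' ->
    conj_class g = conj_class (rep w').
  move=> ok ew' kE gk; have kA : k \in 'Alt_('I_6) by rewrite Alt_even.
  rewrite -(conj_classJ g (a6 k)); congr conj_class; apply/val_inj.
  change (sgval g ^ sgval (a6 k) = sgval (rep w')).
  by rewrite sgval_a6 // gk sgval_rep.
have [hO|hE] := boolP (odd_perm h); last first.
  exists w; first by rewrite mem_rcons inE wE' orbT.
  by apply: conjA6 hE gh; each_word wE'.
pose w' := if w == w5 then w5' else w.
exists w'.
  by rewrite /w'; case: ifP; rewrite mem_rcons inE ?eqxx // wE' orbT.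
apply: (conjA6 (h * word_perm (odd_partner w))).
- by rewrite /w'; each_word wE'.
- by rewrite /w'; each_word wE'.
- by rewrite odd_permM hO odd_word_perm; each_word wE'.
rewrite conjgM gh conjgE; apply: (mulgI (word_perm (odd_partner w))).
rewrite mulVKg -!word_perm_cat /w'; apply: word_perm_eq;
  by each_word wE'.
Qed.

Lemma class_of_table (s : {perm 'I_6}) w : word_ok w ->
  (forall k, (k < 6)%N -> s (o k) = o (word_fun w k)) ->
  conj_class (a6 s) = conj_class (rep w).
Proof.
move=> ok sw; congr (conj_class (a6 _)); apply/permP => i.
by have [k k6 ->] := o_surj i; rewrite sw // (word_permE ok k6).1.
Qed.

Ltac cycle_word :=
  apply: class_of_table => // -[|[|[|[|[|[|]]]]]] // _;
  rewrite ?permM !cycle6E // /points6 /= -!/(o _); do 4?[rewrite ?eq_o //=].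

Lemma class_3E : class_3 = conj_class (rep w3).
Proof. by cycle_word. Qed.
Lemma class_33E : class_33 = conj_class (rep w33).
Proof. by cycle_word. Qed.
Lemma class_22E : class_22 = conj_class (rep w22).
Proof. by cycle_word. Qed.
Lemma class_42E : class_42 = conj_class (rep w42).
Proof. by cycle_word. Qed.
Lemma class_5aE : class_5a = conj_class (rep w5).
Proof. by cycle_word. Qed.
Lemma class_5bE : class_5b = conj_class (rep w5').
Proof. by cycle_word. Qed.

Lemma nontrivial_classes (X : set A6) : is_nontrivial_class X ->
  [\/ X = class_3 \/ X = class_33, X = class_22 |
      [\/ X = class_42, X = class_5a | X = class_5b]].
Proof.
move=> /nontrivial_class_rep[w + ->]; rewrite mem_rcons inE => /orP[/eqP->|wE].
  by constructor 3; constructor 3; rewrite class_5bE.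
rewrite class_3E class_33E class_22E class_42E class_5aE; move: wE.
rewrite /even_words !inE => /orP[/eqP->|/orP[/eqP->|/orP[/eqP->|/orP[] /eqP->]]].
- by constructor 1; left.
- by constructor 1; right.
- by constructor 2.
- by constructor 3; constructor 1.
- by constructor 3; constructor 2.
Qed.

Lemma pt_rep w k : word_ok w -> ~~ odd (size w) -> (k < 6)%N ->
  pt (rep w) (o k) = o (word_fun w k).
Proof. by move=> ok ew k6; rewrite /pt sgval_rep // (word_permE ok k6).1. Qed.

Lemma rep_w3 : rep w3 = g012.
Proof. by apply: pt_eq; do 6?[case=> [|]]; move=> //= _; rewrite pt_rep // pt_g012. Qed.

Lemma rep_w33 : rep w33 = g012 * x_ 3.
Proof.
by apply: pt_eq; do 6?[case=> [|]]; move=> //= _;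
  rewrite pt_rep // ptM pt_g012 // pt_x.
Qed.

Lemma rep_w22 : rep w22 = (x_ 1 * x_ 0) ^ (x_ 0 * x_ 2 * x_ 3).
Proof.
rewrite conjgE; apply: (mulgI (x_ 0 * x_ 2 * x_ 3)); rewrite mulVKg.
by apply: pt_eq; do 6?[case=> [|]]; move=> //= _; rewrite !ptM !pt_x //= pt_rep.
Qed.

Lemma rep_w5_order w : w \in [:: w5; w5'] -> rep w ^+ 5 = 1.
Proof.
move=> wW; apply: pt_eq => k k6; rewrite !expgS expg0 mulg1 pt1 !ptM.
move: wW; rewrite !inE => /orP[] /eqP->; move: k k6; do 6?[case=> [|]]; move=> //= _;
  by rewrite !pt_rep.
Qed.

(** Let g commute with r = (0 1 2 3)(4 5). As r^2 fixes exactly 4 and 5, g maps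
    0 to some r^m(0); then g r^-m commutes with r and fixes 0, hence fixes
    0, 1, 2, 3. *)
Lemma rep_w42_centralizer g : commute g (rep w42) -> exists k, g = rep w42 ^+ k.
Proof.
set r := rep w42 => gr.
have rE k : (k < 6)%N -> pt r (o k) = o (word_fun w42 k) by move=> k6; rewrite pt_rep.
have [m m6 gm] := o_surj (pt g (o 0)).
have rX j : (j < 4)%N -> pt (r ^+ j) (o 0) = o j.
  by case: j => [|[|[|[|]]]] // _; rewrite ?expgS expg0 ?mulg1 ?ptM ?pt1 ?rE.
have m4 : (m < 4)%N.
  rewrite ltnNge; apply/negP => m4.
  have : pt r (pt r (o m)) = o m by case: m m6 m4 {gm} => [|[|[|[|[|[|]]]]]] // _ _;
    rewrite !rE.
  by rewrite -gm -(ptM g r) gr ptM -(ptM g r) gr ptM !rE // => /pt_inj/eqP;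
    rewrite eq_o.
exists m; apply/eqP; rewrite -divg_eq1; apply/eqP; apply: even_fix4 => k k4.
have cr : commute (g * (r ^+ m)^-1) (r ^+ k).
  apply: commuteX; apply: commute_sym; apply: commuteM; first exact: commute_sym.
  by apply: commuteV; apply: commuteX.
by rewrite -(rX k) // -ptM -cr !ptM gm -(rX m) // ptVK.
Qed.

Lemma kappa_classes (E : groupType) (p : UMagmaMorphism.type E A6) :
  versal p -> exists2 c, kernel_generator p c &
  forall x, [/\ class_3 x \/ class_33 x -> kappa_index p c x 2,
    class_22 x -> kappa_index p c x 3 &
    [\/ class_42 x, class_5a x | class_5b x] -> kappa_index p c x 6].
Proof.
move=> vp; have [c [gc k3 k33 k22]] := versal_kernel vp; exists c => // x.
split.
- by move=> []; rewrite ?class_3E ?class_33E ?rep_w3 ?rep_w33 => cx;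
    apply: kappa_conj cx _.
- by rewrite class_22E rep_w22 conj_classJ => cx; apply: kappa_conj cx _.
- case; rewrite ?class_42E ?class_5aE ?class_5bE => cx; apply: (kappa_conj vp cx);
    apply: kappa_trivial => //.
  + by right => g; exact: rep_w42_centralizer.
  + by left; apply: rep_w5_order.
  + by left; apply: rep_w5_order.
Qed.

(** * The relative Schur multipliers *)

(** The class generates a normal subgroup, and A6 is simple. *)
Lemma class_generates (X : set A6) : is_nontrivial_class X -> forall g, sgen X g.
Proof.
move=> [g /eqP g1 XE].
have XJ a b : X a -> X (b * a * b^-1).
  rewrite XE => -[h _ <-]; exists (b * h) => //.
  by rewrite invgM !mulgA.
have SJ a b : sgen X a -> sgen X (b * a * b^-1).
  apply: (sgen_sub (H := [set a | sgen X (b * a * b^-1)])).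
    split=> [|u v Hu Hv|u Hu] /=.
    - by rewrite mulg1 mulgV; exact: sgen1.
    - have -> : b * (u * v) * b^-1 = (b * u * b^-1) * (b * v * b^-1).
        by rewrite !mulgA mulgVK.
      exact: sgenM.
    - have -> : b * u^-1 * b^-1 = (b * u * b^-1)^-1 by rewrite !invgM invgK mulgA.
      exact: sgenV.
  by move=> u Xu; apply: sub_sgen; exact: XJ.
have Xg : X g by rewrite XE; exists 1; rewrite // mul1g invg1 mulg1.
have a6M s t : s \in 'Alt_('I_6) -> t \in 'Alt_('I_6) -> a6 (s * t) = a6 s * a6 t.
  by move=> sA tA; apply/val_inj; rewrite /= !sgval_a6 ?groupM.
pose H := [set s in 'Alt_('I_6) | `[< sgen X (a6 s) >]]%SET.
have HE s : (s \in H) = (s \in 'Alt_('I_6)) && `[< sgen X (a6 s) >]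
  by rewrite finset.in_set.
have gH : group_set H.
  apply/group_setP; split=> [|s t].
    rewrite HE group1; apply/asboolP.
    have -> : a6 1 = 1 by apply/val_inj; rewrite /= sgval_a6.
    exact: sgen1.
  rewrite !HE => /andP[sA /asboolP Ss] /andP[tA /asboolP St].
  by rewrite groupM //; apply/asboolP; rewrite a6M //; exact: sgenM.
have nH : Group gH <| 'Alt_('I_6).
  apply/normalP; split=> [|t tA]; first by apply/fintype.subsetP => s;
    rewrite HE => /andP[].
  apply/eqP; rewrite eqEcard cardJg leqnn andbT.
  apply/fintype.subsetP => _ /imsetP[s + ->]; rewrite !HE => /andP[sA /asboolP Ss].
  rewrite groupJ //=; apply/asboolP.
  have tVA : t^-1 \in 'Alt_('I_6) by rewrite groupV.
  have a6V : (a6 t^-1)^-1 = a6 t by apply/val_inj; rewrite /= !sgval_a6 // invgK.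
  have -> : a6 (s ^ t) = a6 t^-1 * a6 s * (a6 t^-1)^-1.
    by rewrite a6V conjgE !a6M ?groupM // mulgA.
  exact: SJ.
have /simpleP[_ /(_ _ nH)[H1|HA]] : simple 'Alt_('I_6) by apply: simple_Alt5;
  rewrite card_ord.
  have : sgval g \in H.
    by rewrite HE (valP g); apply/asboolP; rewrite a6_sgval; exact: sub_sgen.
  by rewrite [H]H1 => /set1gP gE; case: g1; apply/val_inj; rewrite /= gE.
move=> a; have : sgval a \in H by rewrite [H]HA (valP a).
by rewrite HE => /andP[_ /asboolP]; rewrite a6_sgval.
Qed.

Section FreeMorphisms.
Variable T : choiceType.

Lemma free_generated (w : free_group T) : sgen [set free_gen x | x in setT] w.
Proof.
case: w => w; elim: w => [|[x b] w IHw] rw.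
  by rewrite (_ : FreeGroup rw = 1); [exact: sgen1|apply/val_inj].
have rw' := reduced_behead rw.
pose a : free_group T := if b then (free_gen x)^-1 else free_gen x.
have -> : FreeGroup rw = a * FreeGroup rw'.
  apply/val_inj; rewrite /a; case: (b) rw => rw /=; case: (w) rw => //= c u.
    by rewrite /reduced /= => /andP[/negPf->].
  by rewrite /reduced /= => /andP[/negPf->].
apply: sgenM; last exact: IHw.
by rewrite /a; case: (b); [apply: sgenV|]; apply: sub_sgen; exists x.
Qed.

Lemma free_ext (G : groupType) (f g : UMagmaMorphism.type (free_group T) G) :
  (forall x, f (free_gen x) = g (free_gen x)) -> forall w, f w = g w.
Proof.
by move=> fg w; apply: sgen_eq (free_generated w) => _ [x _ <-]; exact: fg.
Qed.

End FreeMorphisms.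

Section ClassCover.
Variables (X : set A6) (hX : is_nontrivial_class X).
Local Notation F := (free_group X).
Local Notation C := (class_cover X).

Lemma class_pi_surj g : exists w, class_pi (X := X) w = g.
Proof.
apply: (sgen_onto (f := class_pi (X := X))) (class_generates hX g).
move=> x Xx; have xX : x \in X by rewrite inE.
by exists (free_gen (exist (fun x => x \in X) x xX)); exact: free_lift_gen.
Qed.

(** Lifting the generators defines a map from the free group F_X to any central
    extension E'; it maps R_X to the kernel of E', which is central, so that
    [F_X, R_X] dies. *)
Lemma class_cover_versal : exists p : UMagmaMorphism.type C A6,
  (forall e, p e = cover_pi e) /\ versal p.
Proof.
have [p pE] := @morphism_of C A6 _ (@cover_piM A6 X).
exists p; split=> //; split.
  split=> [g|e /= pe].
    by have [w <-] := class_pi_surj g; exists (quot_pi _ w); rewrite pE cover_piE.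
  by apply: cover_ker_central; rewrite -pE.
move=> E' q cq.
pose l (x : X) := sval (cid (ext_lift cq (val x))).
have lE x : q (l x) = val x by exact: svalP (cid (ext_lift cq (val x))).
have qf w : q (free_lift l w) = class_pi w.
  have := @free_ext _ _ (q \o free_lift l) (class_pi (X := X)); apply=> x /=.
  by rewrite free_lift_gen lE; symmetry; exact: free_lift_gen.
have [|f fE] := @quot_factor _ E' (commutator_subgroup setT (class_ker (X := X)))
  (free_lift l).
  apply: (sgen_sub (H := [set w | free_lift l w = 1]));
    first by case: (ker_normal (free_lift l)).
  move=> _ [u _ [v vR <-]] /=; rewrite gmulfR; apply/eqP/commgP/commute_sym.
  by apply: (ker_center cq); rewrite qf.
exists f => e; have [w <-] := quot_pi_surj e.
by rewrite fE qf pE cover_piE.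
Qed.

Lemma schur_setE (e : C) : schur_set e <-> derived C e /\ cover_pi e = 1.
Proof.
split=> [[w [wR wD] <-]|[De pe]].
  split; last by rewrite cover_piE.
  move: w wD {wR}; apply: (sgen_sub (H := [set w | derived C (quot_pi _ w)])).
    exact: preim_subgroup (sgen_subgroup _).
  by move=> _ [u _ [v _ <-]] /=; rewrite gmulfR; exact: derived_comm.
have [w Dw wE] : exists2 w, derived F w & quot_pi (commutator_subgroup setT (class_ker
  (X := X))) w = e.
  move: e De {pe}.
  apply: (sgen_sub (image_subgroup (quot_pi _) (sgen_subgroup _))).
  move=> _ [a _ [b _ <-]]; have [u <-] := quot_pi_surj a; have [v <-] := quot_pi_surj b.
  by exists [~ u, v]; [exact: derived_comm|rewrite gmulfR].
by exists w => //; split=> //; rewrite /class_ker /= -cover_piE wE.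
Qed.

End ClassCover.

Lemma cyclic_iso (G : groupType) (c : G) (n : nat) : (1 < n)%N ->
  (forall g, exists k, g = c ^+ k) -> (forall k, c ^+ k = 1 <-> (n %| k)%N) ->
  group_iso G (cyclic_group n).
Proof.
move=> n1 gen ord.
have cn : c ^+ n = 1 by apply/ord.
have cmod k : c ^+ (k %% n) = c ^+ k.
  by rewrite {2}(divn_eq k n) expgnDr mulnC expgnA cn expg1n mul1g.
have [|f fE] := @morphism_of (cyclic_group n) G (fun a => c ^+ (val (a : 'Z_n))).
  move=> a b; rewrite -expgnDr -[RHS]cmod; congr (_ ^+ _).
  by transitivity ((val (a : 'Z_n) + val (b : 'Z_n)) %% (Zp_trunc n).+2)%N;
    last by congr (_ %% _)%N; exact: Zp_cast.
apply/iso_sym/(iso_of (f := f)) => [a|g].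
  rewrite fE => /ord; rewrite /dvdn modn_small; last first.
    by apply: leq_trans (ltn_ord (a : 'Z_n)) _; rewrite Zp_cast.
  by move=> /eqP a0; apply/val_inj.
have [k ->] := gen g; exists (inZp k : 'Z_n); rewrite fE -[RHS]cmod /=.
by congr (c ^+ (_ %% _)); exact: Zp_cast.
Qed.

Section RelativeMultiplier.
Variables (X : set A6) (p : UMagmaMorphism.type (class_cover X) A6).
Hypotheses (pE : forall e, p e = cover_pi e) (cp : is_central_extension p).

Lemma mu_imageE (x : X) (z : schur_multiplier X) :
  mu_image x z <-> kappa p (val x) (val z).
Proof.
split=> [[g [gx [h [y [hg yx zE]]]]]|[h [y [yx hx zE]]]].
  have hx : commute (p h) (val x) by rewrite pE hg.
  exists h, y; split; [by rewrite pE | by [] | rewrite zE central_commE //].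
  by apply: (comm_center cp); rewrite (pE y) yx.
exists (p h); split=> //; exists h, y; rewrite -!pE; split=> //.
by rewrite zE central_commE //; apply: (comm_center cp); rewrite yx.
Qed.

(** The multiplier is {c^k} and the image of mu_x is {c^(m k)}, where m
    divides 6; so c^k is in the image if and only if m divides k. *)
Lemma relative_multiplier_cyclic (x : X) c m :
  kernel_generator p c -> kappa_index p c (val x) m -> (1 < m)%N -> (m %| 6)%N ->
  group_iso (relative_schur_multiplier x) (cyclic_group m).
Proof.
move=> [Dc pc ord gen] km m1 m6.
have Sc : c \in schur_set (X := X) by rewrite inE; apply/schur_setE; rewrite -pE.
pose s : schur_multiplier X := exist (fun e => e \in schur_set (X := X)) c Sc.
have sX k : val (s ^+ k) = c ^+ k.
  by elim: k => [|k IHk]; rewrite ?val1 // !expgS valM IHk.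
have genS z : exists k, z = s ^+ k.
  have := valP z; rewrite inE => /schur_setE[Dz pz].
  have [|k zE] := gen _ Dz; first by rewrite pE.
  by exists k; apply/val_inj; rewrite sX.
apply: (@cyclic_iso _ (quot_pi (mu_image x) s)) => // [q|k].
  have [z <-] := quot_pi_surj q; have [k ->] := genS z.
  by exists k; exact: gmulfXn.
rewrite -gmulfXn (quot_pi_eq1 _ (@mu_image_normal _ _ x)) mu_imageE sX km.
split=> [[j ck]|/dvdnP[j ->]]; last by exists j; rewrite mulnC.
have : c ^+ (k + 5 * (m * j)) = 1.
  by rewrite expgnDr ck -expgnDr -mulSn; apply/ord; exact: dvdn_mulr.
move=> /ord/(dvdn_trans m6); rewrite dvdn_addl //.
by rewrite dvdn_mull // dvdn_mulr.
Qed.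

End RelativeMultiplier.

Lemma relative_multipliers (X : set A6) (hX : is_nontrivial_class X) (x : X) :
  [/\ X = class_3 \/ X = class_33 ->
        group_iso (relative_schur_multiplier x) (cyclic_group 2),
      X = class_22 ->
        group_iso (relative_schur_multiplier x) (cyclic_group 3)
    & [\/ X = class_42, X = class_5a | X = class_5b] ->
        group_iso (relative_schur_multiplier x) (cyclic_group 6)].
Proof.
have [p [pE vp]] := class_cover_versal hX; have [cp _] := vp.
have [c gc kc] := kappa_classes vp; have [k2 k3 k6] := kc (val x).
have Xx : X (val x) by have := valP x; rewrite inE.
split=> XE.
- apply: (relative_multiplier_cyclic pE cp gc (k2 _)) => //.
  by case: XE => <-; [left|right].
- by apply: (relative_multiplier_cyclic pE cp gc (k3 _)); rewrite -?XE.
- apply: (relative_multiplier_cyclic pE cp gc (k6 _)) => //.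
  by case: XE => <-; [constructor 1|constructor 2|constructor 3].
Qed.

(** * Cyclic groups *)

Section CyclicSubgroups.
Variables (G : groupType) (c : G).
Hypothesis ord : forall k, c ^+ k = 1 <-> (6 %| k)%N.

Let cmod k : c ^+ (k %% 6) = c ^+ k.
Proof.
have c6 : c ^+ 6 = 1 by apply/ord.
by rewrite [in RHS](divn_eq k 6) expgnDr mulnC expgnA c6 expg1n mul1g.
Qed.

Let c_inj (a b : 'I_6) : c ^+ a = c ^+ b -> a = b.
Proof.
have H (i j : 'I_6) : (i <= j)%N -> c ^+ i = c ^+ j -> i = j.
  move=> ij cij; have : c ^+ (j - i) = 1 by rewrite expgnFr // cij mulgV.
  move=> /ord; rewrite /dvdn modn_small; last
    by apply: leq_ltn_trans (leq_subr _ _) (ltn_ord j).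
  by rewrite subn_eq0 => ji; apply/val_inj/eqP; rewrite eqn_leq ij.
move=> cab; case/orP: (leq_total a b) => [ab|ba]; first exact: H.
by apply/esym/H.
Qed.

Lemma exponent_group (N : set G) n : is_subgroup N ->
  (forall z, N z -> exists k, z = c ^+ k) -> (N #= `I_n)%card ->
  exists K : {group 'I_6}, #|K| = n /\ forall k, N (c ^+ k) <-> inZp k \in K.
Proof.
move=> [N1 NM NV] Nc /card_set_bijP[f [fN finj fsurj]].
pose K := [set a : 'I_6 | `[< N (c ^+ a) >]]%SET.
have KE a : (a \in K) = `[< N (c ^+ a) >] by rewrite finset.in_set.
have gK : group_set K.
  apply/group_setP; split=> [|a b]; first by rewrite KE; apply/asboolP.
  rewrite !KE => /asboolP Na /asboolP Nb; apply/asboolP.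
  have -> : c ^+ (a * b)%g = c ^+ a * c ^+ b by rewrite -expgnDr -[RHS]cmod.
  exact: NM.
exists (Group gK); split=> [|k]; last first.
  by rewrite KE /= cmod; split=> [Nk|/asboolP//]; apply/asboolP.
have pK : perm_eq [seq f (c ^+ (a : 'I_6)) | a <- enum K] (iota 0 n).
  apply: uniq_perm; last 1 first.
  - move=> i; rewrite mem_iota /= add0n; apply/mapP/idP => [[a]|i_n].
      by rewrite mem_enum KE => /asboolP Na ->; exact: fN.
    have [z Nz zi] := fsurj _ i_n; have [k zE] := Nc _ Nz.
    exists (inZp k); last by rewrite /= cmod -zE.
    by rewrite mem_enum KE /= cmod -zE; apply/asboolP.
  - rewrite map_inj_in_uniq ?enum_uniq // => a b; rewrite !mem_enum !KE.
    by move=> /asboolP Na /asboolP Nb /finj E; apply/c_inj/E; rewrite inE.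
  - exact: iota_uniq.
by have := perm_size pK; rewrite size_map size_iota -cardE.
Qed.

(** The exponents form a subgroup of Z/6, and a cyclic group has at most one
    subgroup of each order. *)
Lemma subgroup_unique (N N' : set G) n :
  is_subgroup N -> is_subgroup N' ->
  (forall z, N z -> exists k, z = c ^+ k) -> (forall z, N' z -> exists k, z = c ^+ k) ->
  (N #= `I_n)%card -> (N' #= `I_n)%card -> N' = N.
Proof.
move=> sN sN' Nc N'c cN cN'.
have [K [Kn KE]] := exponent_group sN Nc cN.
have [K' [K'n K'E]] := exponent_group sN' N'c cN'.
have KK : K = K' :> {set 'I_6}.
  apply/eqP; rewrite (@eq_subG_cyclic _ [group of [set: 'I_6]]) ?Kn ?K'n
    ?finset.subsetT //.
  by apply/cyclicP; exists Zp1; exact: Zp_cycle.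
apply/seteqP; split=> z Nz.
  by have [k zE] := N'c _ Nz; rewrite zE KE KK -K'E -zE.
by have [k zE] := Nc _ Nz; rewrite zE K'E -KK -KE -zE.
Qed.

Lemma multiples_card m n : (n * m = 6)%N ->
  ([set z | exists k, z = c ^+ (m * k)] #= `I_n)%card.
Proof.
move=> nm; have m0 : (0 < m)%N by case: m nm => //; rewrite muln0.
have n0 : (0 < n)%N by case: n nm.
have -> : [set z | exists k, z = c ^+ (m * k)] = [set c ^+ (m * k) | k in `I_n].
  apply/seteqP; split=> [_ [k ->]|_ [k _ <-]]; last by exists k.
  exists (k %% n)%N; first by rewrite /= ltn_pmod.
  by rewrite -cmod -nm (mulnC n) muln_modr -[RHS]cmod -nm (mulnC n) // modn_mod.
apply: inj_card_eq => j k; rewrite !inE /= => j_n k_n.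
have lt i : (i < n)%N -> (m * i < 6)%N by move=> i_n; rewrite -nm mulnC ltn_pmul2r.
move=> E; have /(congr1 val)/eqP := @c_inj (Ordinal (lt _ j_n)) (Ordinal (lt _ k_n)) E.
by rewrite /= eqn_pmul2l // => /eqP.
Qed.

End CyclicSubgroups.

Section IntegerPowers.
Import GRing.Theory.

Lemma int_hom (G : groupType) (z : G) :
  exists F : UMagmaMorphism.type infinite_cyclic_group G, F (1%R : int) = z.
Proof.
pose f (k : int) : G := match k with Posz n => z ^+ n | Negz n => (z ^+ n.+1)^-1 end.
have fS k : f (k + 1)%R = f k * z.
  case: k => [n|n]; first by rewrite /= addn1 expgSr.
  rewrite NegzE -addn1 PoszD opprD addrNK.
  rewrite -opprD -PoszD addn1; case: n => [|n].
    by rewrite oppr0 -NegzE /f expg1 mulVg.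
  by rewrite -!NegzE /f [in RHS]expgS invgM mulgVK.
have fB k : f (k - 1)%R = f k * z^-1 by rewrite -[in RHS](subrK 1%R k) fS mulgK.
have fD k l : f (k + l)%R = f k * f l.
  elim/int_rect: l => [|n IHn|n IHn]; first by rewrite addr0 mulg1.
    by rewrite intS (addrC 1%R) addrA !fS IHn mulgA.
  by rewrite intS opprD (addrC (- 1)%R) addrA !fB IHn mulgA.
have [F FE] := @morphism_of infinite_cyclic_group G f fD.
by exists F; rewrite FE.
Qed.

Lemma int_generated (H : set infinite_cyclic_group) :
  is_subgroup H -> H (1%R : int) -> forall k, H k.
Proof.
move=> [H0 HM HV] H1 k; elim/int_rect: k => [//|n Hn|n Hn].
  by rewrite intS; exact: (HM (1%R : int) (Posz n)).
by rewrite intS opprD; exact: (HM (- 1)%R (- Posz n)%R (HV (1%R : int) H1) Hn).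
Qed.

End IntegerPowers.

(** * The associated group *)

Section UniversalExtension.
Variables (E : groupType) (p : UMagmaMorphism.type E A6).
Hypothesis up : is_universal_central_extension p.

Lemma universal_versal : versal p.
Proof.
have [cp u] := up; split=> // E' q cq.
by have [f [qf _]] := u _ _ cq; exists f.
Qed.

Lemma universal_unique (E' : groupType) (q : UMagmaMorphism.type E' A6)
    (f f' : UMagmaMorphism.type E E') :
  is_central_extension q -> (forall e, q (f e) = p e) ->
  (forall e, q (f' e) = p e) -> forall e, f e = f' e.
Proof.
move=> cq qf qf' e; have [_ u] := up; have [g [_ gu]] := u _ _ cq.
by rewrite (gu f) // (gu f').
Qed.

Lemma derived_normal (G : groupType) : is_normal (derived G).
Proof.
split=> [|g x Dx]; first exact: sgen_subgroup.
rewrite -(mulgVK x (g * x * g^-1)); apply: sgenM => //.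
have -> : g * x * g^-1 * x^-1 = [~ g^-1, x^-1] by rewrite commgEl conjgE !invgK !mulgA.
exact: derived_comm.
Qed.

(** Let Q = E / [E, E]. The maps e |-> (e [E, E], p e) and e |-> (1, p e) to the
    central extension Q x A6 agree by uniqueness, so Q is trivial. *)
Lemma universal_perfect e : derived E e.
Proof.
have [cp _] := up.
pose Q := quot_group (derived E).
have Qab (a b : Q) : a * b = b * a.
  have [u <-] := quot_pi_surj a; have [v <-] := quot_pi_surj b.
  apply/commgP; rewrite -gmulfR; apply/eqP/(quot_pi_eq1 _ (derived_normal E)).
  exact: derived_comm.
have [q qE] : exists q : UMagmaMorphism.type (Q * A6)%type A6, forall a, q a = a.2.
  by apply: morphism_of.
have [f1 f1E] : exists f : UMagmaMorphism.type E (Q * A6)%type,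
    forall a, f a = (quot_pi (derived E) a, p a).
  by apply: morphism_of => a b; rewrite !gmulfM.
have [f2 f2E] : exists f : UMagmaMorphism.type E (Q * A6)%type,
    forall a, f a = (1, p a).
  by apply: morphism_of => a b; rewrite gmulfM; congr (_, _); rewrite /= mul1g.
have cq : is_central_extension q.
  split=> [g|[a b] /=]; first by exists (1, g); rewrite qE.
  by rewrite qE /= => -> [a' b']; congr (_, _); rewrite /= ?mul1g ?mulg1.
have f12 : f1 e = f2 e.
  by apply: (universal_unique cq) => a; rewrite qE ?f1E ?f2E.
apply/(quot_pi_eq1 _ (derived_normal E)).
by move: f12; rewrite f1E f2E => -[].
Qed.

End UniversalExtension.

Section AssociatedGroup.
Variables (X : set A6) (hX : is_nontrivial_class X).
Local Notation As := (associated_group X).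

Definition as_gen (x : X) : As := quot_pi (@rack_relators _ X) (free_gen x).

Lemma as_generated (g : As) : sgen [set as_gen x | x in setT] g.
Proof.
have [w <-] := quot_pi_surj g.
apply: (sgen_sub (preim_subgroup (quot_pi _) (sgen_subgroup _))) (free_generated w) =>
  _ [x _ <-].
by apply: sub_sgen; exists x.
Qed.

Lemma as_lift (G : groupType) (f : X -> G) :
  (forall x y z : X, val z = val x * val y * (val x)^-1 ->
    f z = f x * f y * (f x)^-1) ->
  exists F : UMagmaMorphism.type As G, forall x, F (as_gen x) = f x.
Proof.
move=> fX.
have [L LE] : exists L : UMagmaMorphism.type (free_group X) G,
    forall x, L (free_gen x) = f x by exists (free_lift f); exact: free_lift_gen.
have [|F FE] := @quot_factor _ G (@rack_relators _ X) L.
  by move=> _ [x [y [z [zE ->]]]]; rewrite !gmulfM !gmulfV !LE (fX _ _ _ zE) mulgV.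
by exists F => x; rewrite FE LE.
Qed.

Lemma as_rel (x y z : X) : val z = val x * val y * (val x)^-1 ->
  as_gen x * as_gen y * (as_gen x)^-1 = as_gen z.
Proof.
move=> zE; apply: divg1_eq.
have <- : quot_pi (@rack_relators _ X) 1 = 1 by exact: gmulf1.
have -> : as_gen x * as_gen y * (as_gen x)^-1 * (as_gen z)^-1 =
    quot_pi (@rack_relators _ X) (free_gen x * free_gen y * (free_gen x)^-1 *
      (free_gen z)^-1).
  by rewrite !quot_piM !quot_piV.
apply/esym/quot_piP; rewrite invg1 mul1g.
by apply: sub_normal_closure; exists x, y, z.
Qed.

Lemma class_conj (a : A6) (x : X) : exists y : X, val y = a * val x * a^-1.
Proof.
have XJ b : X b -> X (a * b * a^-1).
  have [g _ ->] := hX => -[h _ <-]; exists (a * h) => //.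
  by rewrite invgM !mulgA.
have yX : a * val x * a^-1 \in X by rewrite inE; apply: XJ; have := valP x; rewrite inE.
by exists (exist (fun x => x \in X) _ yX).
Qed.

(** Elements of As(X) conjugate the generators in the way their images in A6
    conjugate X. An element over 1 thus commutes with all generators. *)
Lemma as_proj : exists q : UMagmaMorphism.type As A6,
  (forall x, q (as_gen x) = val x) /\ 
  (forall g x y, val y = q g * val x * (q g)^-1 -> g * as_gen x * g^-1 = as_gen y) /\
  is_central_extension q.
Proof.
have [q qE] := @as_lift A6 val (fun _ _ _ E => E).
have act g x y : val y = q g * val x * (q g)^-1 -> g * as_gen x * g^-1 = as_gen y.
  move: g (as_generated g) x y.
  apply: (sgen_sub (H := [set g | forall x y, val y = q g * val x * (q g)^-1 ->
    g * as_gen x * g^-1 = as_gen y])).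
    split=> [x y|u v /= Hu Hv x y|u /= Hu x y] /=.
    - rewrite gmulf1 !invg1 !mulg1 !mul1g => yx.
      by have -> : y = x by apply/val_inj.
    - rewrite gmulfM => yE; have [z zE] := class_conj (q v) x.
      have -> : u * v * as_gen x * (u * v)^-1 = u * (v * as_gen x * v^-1) * u^-1.
        by rewrite invgM !mulgA.
      by rewrite (Hv _ _ zE); apply: Hu; rewrite yE zE invgM !mulgA.
    - rewrite gmulfV invgK => yE.
      have <- : u * as_gen y * u^-1 = as_gen x.
        by apply: Hu; rewrite yE !mulgA mulgV mul1g mulgK.
      by rewrite invgK !mulgA mulVg mul1g mulgVK.
  by move=> _ [x' _ <-] x y /=; rewrite qE => yE; rewrite (as_rel yE).
exists q; split=> //; split=> //; split=> [a|g /= qg].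
  apply: (sgen_onto (f := q)) (class_generates hX a) => x Xx.
  have xX : x \in X by rewrite inE.
  by exists (as_gen (exist (fun x => x \in X) x xX)); rewrite qE.
move=> h; apply: (sgen_sub (centralizer_subgroup g)) (as_generated h) => _ [x _ <-] /=.
have gx : g * as_gen x * g^-1 = as_gen x by apply: act; rewrite qg invg1 mulg1 mul1g.
by rewrite -[in RHS]gx mulgVK.
Qed.

End AssociatedGroup.

(** In this section N is the image of mu_x in the universal extension E. *)
Section AssociatedQuotient.
Variables (X : set A6) (hX : is_nontrivial_class X) (x0 : X).
Variables (E : groupType) (p : UMagmaMorphism.type E A6).
Hypothesis up : is_universal_central_extension p.
Variables (c : E) (m : nat).
Hypotheses (gc : kernel_generator p c) (km : kappa_index p c (val x0) m).
Local Notation As := (associated_group X).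
Let N : set E := [set z | exists k, z = c ^+ (m * k)].

Lemma kappa_subgroup : is_subgroup N.
Proof.
have [_ _ ord _] := gc.
split=> [|_ _ [j ->] [k ->]|_ [k ->]]; first by exists 0%N; rewrite muln0.
  by exists (j + k)%N; rewrite mulnDr expgnDr.
exists (k * 5)%N; apply: (mulgI (c ^+ (m * k))).
rewrite mulgV -expgnDr; apply/esym/ord.
by rewrite mulnA -[X in (X + _)%N]muln1 -mulnDr dvdn_mull.
Qed.

Lemma kappa_central : N `<=` @center E.
Proof.
have [[cp _] [_ pc _ _]] := (up, gc).
by move=> _ [k ->]; apply: centerX; exact: (ker_center cp).
Qed.

Lemma exists_conjugator (x : X) : exists e, p e * val x0 * (p e)^-1 = val x.
Proof.
have [cp _] := up; have [g _ XE] := hX.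
have XP (y : X) : exists a : A6, a * g * a^-1 = val y.
  have [a _ ya] : conj_class g (val y) by rewrite -XE; have := valP y; rewrite inE.
  by exists a.
have [a <-] := XP x; have [b <-] := XP x0; have [e pe] := ext_lift cp (a * b^-1).
by exists e; rewrite pe invgM invgK !mulgA !mulgVK.
Qed.

(** If p h commutes with x, then f h commutes with the generator g_x, which has
    the same image in A6 as f y; so f kills [h, y]. For the converse, a map
    B from As(X) to E / N with B \o f equal to the projection is built from
    b x = e s e^-1, where e is any element such that p e conjugates x0 to x.
    Another choice of e changes e s e^-1 by a commutator [h, s] in N. *)
Lemma kernel_to_associated_group (q : UMagmaMorphism.type As A6)
    (f : UMagmaMorphism.type E As) :
  (forall x, q (as_gen x) = val x) ->
  (forall g x y, val y = q g * val x * (q g)^-1 -> g * as_gen x * g^-1 = as_gen y) ->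
  is_central_extension q -> (forall e, q (f e) = p e) ->
  forall e, f e = 1 <-> N e.
Proof.
move=> qx act cq qf e; have [cp _] := up.
have [s ps] := ext_lift cp (val x0).
split=> [fe|/km[h [y [py hx ->]]]]; last first.
  rewrite gmulfR (comm_lift cq (a' := f h) (b' := as_gen x0)) //; last first.
    by rewrite qf qx.
  apply/eqP/commgP; rewrite /commute.
  have E0 : f h * as_gen x0 * (f h)^-1 = as_gen x0.
    by apply: act; rewrite qf hx mulgK.
  by rewrite -[in RHS]E0 mulgVK.
pose a x := sval (cid (exists_conjugator x)).
have aE x : p (a x) * val x0 * (p (a x))^-1 = val x
  by exact: svalP (cid (exists_conjugator x)).
have nN := central_normal kappa_subgroup kappa_central.
pose b x := quot_pi N (a x * s * (a x)^-1).
have bE x k : p k * val x0 * (p k)^-1 = val x -> quot_pi N (k * s * k^-1) = b x.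
  move=> ex; pose h := (a x)^-1 * k.
  have hx : commute (p h) (val x0).
    have := etrans ex (esym (aE x)) => /(congr1 (fun g => (p (a x))^-1 * g * p k)).
    by rewrite !mulgA !mulgVK mulVg mul1g /h gmulfM gmulfV /commute => ->;
      rewrite !mulgA.
  have Nz : N [~ h, s] by apply/km; exists h, s.
  have -> : k * s * k^-1 = a x * s * (a x)^-1 * [~ h, s].
    have Cz := kappa_central Nz.
    have hs : h * s * h^-1 = [~ h, s] * s by rewrite -(central_commE Cz) mulgVK.
    have -> : k * s * k^-1 = a x * (h * s * h^-1) * (a x)^-1.
      by rewrite /h invgM invgK !mulgA mulgV mul1g mulgK.
    rewrite hs; move: [~ h, s] Cz => C Cz.
    by rewrite (mulgCA_central _ _ Cz) -(Cz (a x * s * (a x)^-1)) !mulgA.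
  by rewrite quot_piM (_ : quot_pi N [~ h, s] = 1) ?mulg1 //; apply/(quot_pi_eq1 _ nN).
have [x y z zE|B BE] := @as_lift X _ b.
  pose ex := a x * s * (a x)^-1.
  have -> : b x * b y * (b x)^-1 = quot_pi N (ex * (a y * s * (a y)^-1) * ex^-1).
    have J u v :
        quot_pi N u * quot_pi N v * (quot_pi N u)^-1 = quot_pi N (u * v * u^-1).
      by rewrite !quot_piM quot_piV.
    exact: J.
  have -> : ex * (a y * s * (a y)^-1) * ex^-1 = (ex * a y) * s * (ex * a y)^-1.
    by rewrite (invgM ex) !mulgA.
  apply/esym/bE; rewrite gmulfM invgM zE -(aE y).
  have -> : p ex = val x by rewrite /ex !gmulfM gmulfV ps aE.
  by rewrite !mulgA.
have pN z : N z -> p z = 1 by have [_ pc _ _] := gc; move=> [k ->];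
  rewrite gmulfXn pc expg1n.
have [r rE] := quot_factor pN.
have cr : is_central_extension r.
  split=> [g|w /=]; first by have [t <-] := ext_lift cp g; exists (quot_pi N t).
  have [t <-] := quot_pi_surj w; rewrite rE => pt1 w'; have [t' <-] := quot_pi_surj w'.
  by rewrite -!gmulfM (ker_center cp pt1).
have rB g : r (B g) = q g.
  apply: (sgen_eq (f := r \o B) (f' := q)) (as_generated g) => _ [x _ <-] /=.
  by rewrite BE rE !gmulfM gmulfV ps aE qx.
have [|F FE] := @morphism_of _ _ (B \o f); first by move=> u v; rewrite /= !gmulfM.
have H : F e = quot_pi N e.
  apply: (universal_unique up cr (f := F) (f' := quot_pi N)) => u; last exact: rE.
  by rewrite FE /= rB qf.
by apply/(quot_pi_eq1 _ nN); rewrite -H FE /= fe gmulf1.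
Qed.

(** The map P sends (e, k) to f(e) z^k, where z = f(s)^-1 g_x0 is central. The
    degree d of z is 1 and d vanishes on f(E), E being perfect, so the kernel of
    P is N x 1. The map is onto because g_x = f(e) (f(s) z) f(e)^-1 if p e
    conjugates x0 to x. *)
Lemma associated_group_iso : group_iso As (quot_group ((N `*` [set 1]) :
  set (E * infinite_cyclic_group)%type)).
Proof.
have [cp uex] := up; have [q [qx [act cq]]] := as_proj hX.
have [f [qf _]] := uex _ _ cq.
have fN := kernel_to_associated_group qx act cq qf.
have [|d dE] := @as_lift X infinite_cyclic_group (fun=> 1%R : int);
  first by move=> x y z _; rewrite mulgK.
have df e : d (f e) = 1.
  apply: (sgen_sub (preim_subgroup f (ker_normal d).1)) (universal_perfect up e).
  move=> _ [u _ [v _ <-]] /=; rewrite !gmulfR; apply/eqP/commgP.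
  exact: GRing.addrC.
have [s ps] := ext_lift cp (val x0).
pose z := (f s)^-1 * as_gen x0.
have qz : q z = 1 by rewrite gmulfM gmulfV qf ps qx mulVg.
have Cz : center z := ker_center cq qz.
have dz : d z = (1%R : int) by rewrite gmulfM gmulfV df invg1 mul1g dE.
have [Z Z1] := int_hom z.
have CZ k : center (Z k).
  by apply: (int_generated (preim_subgroup Z (center_subgroup _))); rewrite /= Z1.
have dZ k : d (Z k) = k.
  apply: (sgen_eq (f := d \o Z) (f' := idfun) (A := [set (1%R : int)])).
    by move=> _ -> /=; rewrite Z1.
  by apply: int_generated; [exact: sgen_subgroup | exact: sub_sgen].
have [P PE] : exists P : UMagmaMorphism.type (E * infinite_cyclic_group)%type As,
    forall a, P a = f a.1 * Z a.2.
  apply: morphism_of => a b; rewrite !gmulfM -!mulgA; congr (_ * _).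
  by rewrite (mulgCA_central _ _ (CZ _)).
have kerP a : P a = 1 <-> (N `*` [set 1]) a.
  case: a => e k; rewrite PE /=; split=> [fz|[/fN -> ->]]; last by rewrite gmulf1 mulg1.
  have k1 : k = 1.
    by have := congr1 d fz; rewrite gmulfM df dZ mul1g gmulf1.
  by split=> //; apply/fN; move: fz; rewrite k1 gmulf1 mulg1.
have kerE : N `*` [set 1] = [set a | P a = 1] by apply/seteqP; split=> a /kerP.
have [|F FE] := @quot_factor _ As (N `*` [set 1]) P; first by move=> a /kerP.
apply/iso_sym/(iso_of (f := F)) => [w|g].
  have [a <-] := quot_pi_surj w; rewrite FE => /kerP Na; apply/quot_pi_eq1 => //.
  by rewrite kerE; exact: ker_normal.
apply: (sgen_onto (f := F)) (as_generated g).
move=> _ [x _ <-]; have [e pe] := exists_conjugator x.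
exists (quot_pi _ ((e * s * e^-1, 1%R : int) : E * infinite_cyclic_group)).
rewrite FE PE /= Z1 !gmulfM gmulfV.
have ze : z * (f e)^-1 = (f e)^-1 * z by rewrite Cz.
rewrite -mulgA -ze mulgA -(mulgA (f e)) mulVKg.
by apply: act; rewrite qf.
Qed.

End AssociatedQuotient.

(** Central elements of E map to the center of A6, hence to 1, so the center of E
    is the cyclic group {c^k} of order 6. *)
Lemma associated_group_quotient (X : set A6) (hX : is_nontrivial_class X)
    (E : groupType) (p : UMagmaMorphism.type E A6) (x0 : X) c m n :
  is_universal_central_extension p ->
  kernel_generator p c -> kappa_index p c (val x0) m -> (n * m = 6)%N ->
  exists N : set E,
    [/\ is_central_subgroup_of_order n N,
        forall N' : set E, is_central_subgroup_of_order n N' -> N' = N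
      & group_iso (associated_group X)
          (@quot_group (E * infinite_cyclic_group)%type (N `*` [set 1]))].
Proof.
move=> up gc km nm; have [_ pc ord gen] := gc; have [cp _] := up.
pose N : set E := [set z | exists k, z = c ^+ (m * k)].
have sN : is_subgroup N := kappa_subgroup m gc.
have cN : (N #= `I_n)%card := multiples_card ord nm.
have NC : N `<=` @center E := @kappa_central _ _ up _ m gc.
exists N; split=> [//|N' [sN' N'C cN']|]; last exact: (associated_group_iso hX up gc
  km).
apply: (subgroup_unique ord sN sN' _ _ cN cN') => [z [k ->]|z N'z].
  by exists (m * k)%N.
apply: gen; first exact: universal_perfect up z.
apply: A6_center => g; have [e <-] := ext_lift cp g.
by rewrite -!gmulfM (N'C _ N'z).
Qed.

Theorem theorem6p14 (X : set A6) (hX : is_nontrivial_class X) :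
  (forall x : X,
     [/\ X = class_3 \/ X = class_33 ->
           group_iso (relative_schur_multiplier x) (cyclic_group 2),
         X = class_22 ->
           group_iso (relative_schur_multiplier x) (cyclic_group 3)
       & [\/ X = class_42, X = class_5a | X = class_5b] ->
           group_iso (relative_schur_multiplier x) (cyclic_group 6)])
  /\
  (forall n : set A6 -> nat,
     n class_3 = 3%N -> n class_33 = 3%N ->
     n class_22 = 2%N ->
     n class_42 = 1%N -> n class_5a = 1%N -> n class_5b = 1%N ->
   forall (A6s : groupType) (p : UMagmaMorphism.type A6s A6),
     is_universal_central_extension p ->
   exists N : set A6s,
     [/\ is_central_subgroup_of_order (n X) N,
         forall N' : set A6s, is_central_subgroup_of_order (n X) N' -> N' = N
       & group_iso (associated_group X)
           (@quot_group (A6s * infinite_cyclic_group)%type (N `*` [set 1]))]).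
Proof.
split=> [x|n n3 n33 n22 n42 n5a n5b A6s p up]; first exact: relative_multipliers.
have [c gc kc] := kappa_classes (universal_versal up).
have [g _ XE] := hX.
have gX : g \in X by rewrite inE XE; exists 1; rewrite // mul1g invg1 mulg1.
pose x0 : X := exist (fun x => x \in X) g gX.
have Xg : X g by have := gX; rewrite inE.
have [k2 k3 k6] := kc (val x0).
have main m : kappa_index p c (val x0) m -> (n X * m = 6)%N -> _ :=
  fun km nm => associated_group_quotient hX up gc km nm.
case: (nontrivial_classes hX) => [X3|X2|X6].
- apply: (main 2%N); first by apply: k2; case: X3 => <-; [left|right].
  by case: X3 => ->; rewrite ?n3 ?n33.
- by apply: (main 3%N); [apply: k3; rewrite -X2|rewrite X2 n22].
- apply: (main 6%N).
    by apply: k6; case: X6 => <-; [constructor 1|constructor 2|constructor 3].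
  by case: X6 => ->; rewrite ?n42 ?n5a ?n5b.
Qed.
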